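(* Let $0<\alpha\le1$. Let $X$ be a (real) Hilbert space with inner product $\langle\cdot,\cdot\rangle$ and norm $|\cdot|$, let $\emptyset\ne E\subset X$, and let $f:E\to\mathbb{R}$, $G:E\to X$ be arbitrary functions. (i) There exists a convex function $F\in C^{1,\alpha}(X)$ with $F=f$ and $\nabla F=G$ on $E$ if and only if there is some $M>0$ such that $$f(y)\ge f(z)+\langle G(z),y-z\rangle+\frac{\alpha}{(1+\alpha)M^{1/\alpha}}|G(y)-G(z)|^{1+\frac1\alpha}\quad\text{for all }y,z\in E. \quad ( * )$$ (ii) If $( * )$ holds with constant $M>0$, then the formula $$F:=\operatorname{conv}(g),\qquad g(x)=\inf_{y\in E}\left\{f(y)+\langle G(y),x-y\rangle+\frac{M}{1+\alpha}|x-y|^{1+\alpha}\right\},\quad x\in X,$$ defines such an extension ($F\in C^{1,\alpha}(X)$ convex, $(F,\nabla F)=(f,G)$ on $E$), and $$A_{\alpha,\mathrm{co}}(F,\nabla F,X)\le 2^{1-\alpha}M\quad\text{and}\quad\operatorname{Lip}_\alpha(\nabla F,X)\le 2^{1-\alpha}\left(\frac{1+\alpha}{2\alpha}\right)^{\alpha}M.$$ (iii) If, in addition to $( * )$ with constant $M>0$, $G$ is bounded and $L:=\sup_{z\in E}|G(z)|$, then $F_L:=\operatorname{conv}_L(g)$, with the same $g$ as in (ii), has the same properties as $F$ (convex, in $C^{1,\alpha}(X)$, $(F_L,\nabla F_L)=(f,G)$ on $E$, and both estimates in (ii) hold for $F_L$), and moreover $F_L$ is Lipschitz on $X$ with $$\sup_{x\in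 X}|\nabla F_L(x)|=\operatorname{Lip}(F_L,X)=L=\sup_{z\in E}|G(z)|.$$
   Context: The dual $X^*$ is identified with $X$, and $\nabla F(x)\in X$ represents the Fréchet derivative of $F$ at $x$. For $E\subset X$ and a map $H$ from $E$ to a normed space $Y$, $\operatorname{Lip}_\alpha(H,E)=\sup_{x\ne z\in E}\frac{\|H(x)-H(z)\|_Y}{|x-z|^\alpha}$, and $\operatorname{Lip}(H,E)$ is the case $\alpha=1$. $C^{1,\alpha}(X)$ is the class of everywhere Fréchet differentiable $F:X\to\mathbb{R}$ with continuous $\nabla F$ and $\operatorname{Lip}_\alpha(\nabla F,X)<\infty$. For $f:E\to\mathbb{R}$, $G:E\to X$, $$A_{\alpha,\mathrm{co}}(f,G,E)=\sup\left\{\frac{f(z)+\langle G(z),x-z\rangle-f(y)-\langle G(y),x-y\rangle}{\frac{1}{1+\alpha}|x-y|^{1+\alpha}}: y,z\in E,\ x\in X,\ x\neq y\right\}\in[0,+\infty].$$ Suprema over the empty set are $0$ in these definitions. For $g:X\to\mathbb{R}$ with a continuous affine minorant, $\operatorname{conv}(g)(x)=\sup\{h(x): h:X\to\mathbb{R}\text{ convex and continuous},\ h\le g\text{ on }X\}$. For $L\ge0$ and $g$ with an $L$-Lipschitz affine minorant, $\operatorname{conv}_L(g)(x)=\sup\{h(x):h:X\to\mathbb{R}\text{ convex and }L\text{-Lipschitz},\ h\le g\text{ on }X\}$. *)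

(* Defs.v *)
From HB Require Import structures.
From mathcomp Require Import all_boot all_order all_algebra.
From mathcomp Require Import all_classical all_reals all_analysis.

Set Implicit Arguments.
Unset Strict Implicit.
Unset Printing Implicit Defensive.

Import Order.TTheory GRing.Theory Num.Theory.
Import numFieldNormedType.Exports.

Local Open Scope classical_set_scope.
Local Open Scope ring_scope.

(* A function on a set E is represented by a total function, of which only the
   values on E are ever used. *)

(* Supremum with the convention sup(empty) = 0 (ereal_sup set0 is -oo). *)
Definition esup0 (R : realType) (A : set (\bar R)) : \bar R :=
  if A == set0 then 0%E else ereal_sup A.

Definition Lip (R : realType) (X : normedModType R) (Y : normedZmodType R)
    (a : R) (E : set X) (H : X -> Y) : \bar R :=
  esup0 [set r | exists x z, [/\ E x, E z, x <> z &
    r = (`|H x - H z| / `|x - z| `^ a)%:E]].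

Section inner_product.
Variables (R : realType) (X : normedModType R) (dot : {dot X for idfun}).

(* The vector representing the Frechet derivative 'd F x; when X is a Hilbert
   space and F is differentiable at x it exists and is unique (Riesz), so the
   default value 0 is irrelevant. *)
Definition gradient (F : X -> R^o) (x : X) : X :=
  xget 0 [set v | forall h, 'd F x h = dot v h].

Definition C1 (a : R) (F : X -> R^o) : Prop :=
  [/\ forall x, differentiable F x,
      continuous (gradient F) &
      (Lip a setT (gradient F) < +oo)%E].

Definition Aco (a : R) (E : set X) (f : X -> R) (G : X -> X) : \bar R :=
  esup0 [set r | exists y z x, [/\ E y, E z, x <> y &
    r = ((f z + dot (G z) (x - z) - f y - dot (G y) (x - y)) /
         ((1 + a)^-1 * `|x - y| `^ (1 + a)))%:E]].

Definition whitney_convex (a M : R) (E : set X) (f : X -> R) (G : X -> X) :=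
  forall y z, E y -> E z ->
    f z + dot (G z) (y - z) +
      a / ((1 + a) * M `^ a^-1) * `|G y - G z| `^ (1 + a^-1) <= f y.

Definition envelope_set (a M : R) (E : set X) (f : X -> R) (G : X -> X)
    (x : X) : set R :=
  [set f y + dot (G y) (x - y) + M / (1 + a) * `|x - y| `^ (1 + a) | y in E].

Definition envelope (a M : R) (E : set X) (f : X -> R) (G : X -> X)
    (x : X) : R :=
  inf (envelope_set a M E f G x).

Definition extends_jet (a : R) (E : set X) (f : X -> R) (G : X -> X)
    (F : X -> R^o) : Prop :=
  [/\ convex_function (setT : set (convex_lmodType X)) F,
      C1 a F &
      forall y, E y -> F y = f y /\ gradient F y = G y].

End inner_product.

Section convex_envelopes.
Variables (R : realType) (X : normedModType R).

Definition affine_function (h : X -> R^o) : Prop :=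
  exists (l : {linear X -> R^o}) (c : R), forall x, h x = l x + c.

(* The real-valued sup is the intended one as soon as g has a continuous
   affine minorant (resp. an L-Lipschitz one, for convL). *)
Definition conv_env (g : X -> R) (x : X) : R :=
  sup [set r | exists h : X -> R^o,
    [/\ convex_function (setT : set (convex_lmodType X)) h,
        continuous h,
        forall y, h y <= g y &
        r = h x]].

Definition convL_env (L : R) (g : X -> R) (x : X) : R :=
  sup [set r | exists h : X -> R^o,
    [/\ convex_function (setT : set (convex_lmodType X)) h,
        L.-lipschitz h,
        forall y, h y <= g y &
        r = h x]].

End convex_envelopes.

(* Main.v *)
Require Import Defs.
From HB Require Import structures.
From mathcomp Require Import all_boot all_order all_algebra.
From mathcomp Require Import all_classical all_reals all_analysis.
From mathcomp Require Import ring lra.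

Set Implicit Arguments.
Unset Strict Implicit.
Unset Printing Implicit Defensive.

Import Order.TTheory GRing.Theory Num.Theory.
Import numFieldNormedType.Exports.

Local Open Scope classical_set_scope.
Local Open Scope ring_scope.

(* Put C = 2^(1-a).  In a Hilbert space |x|^(1+a) has gradient
   (1+a) |x|^(a-1) x, and u |-> |u|^(a-1) u is a-Hoelder with constant C; hence
   |x + h|^(1+a) lies below its first-order expansion plus C |h|^(1+a).  Taking
   the combination of the points x - e k and x + k in which first-order terms
   cancel gives an inequality free of derivatives ([upper_smooth]), which
   passes from the functions defining g to their infimum g, and from g to any
   supremum F of convex minorants of g: the corresponding combination of
   translates of F, minus a constant, is itself an admissible minorant.
   A convex function satisfying it has a linear directional derivative, so it
   has a gradient by the Riesz theorem, and e -> 0 gives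
   F(y + k) <= F(y) + <grad F(y), k> + C M/(1+a) |k|^(1+a), the bound on Aco.
   By Fenchel-Young, the Whitney condition with constant M' says exactly that
   the affine functions f(z) + <G z, x - z> lie below the functions
   f(y) + <G y, x - y> + M'/(1+a) |x - y|^(1+a).  Hence F satisfies it on X with
   M' = C M, and adding the two instances for y and z gives the Hoelder bound
   on the gradient. *)

(** * Inequalities for real powers *)

Section powR_inequalities.
Variable R : realType.
Implicit Types a p t u v x y : R.

Lemma ler_powRl a x y : 0 <= a -> 0 <= x -> x <= y -> x `^ a <= y `^ a.
Proof.
move=> a0 x0 xy; apply: ge0_ler_powR; rewrite ?nnegrE//.
exact: le_trans xy.
Qed.

(** Young's inequality for u^(p-1) and v with exponents p/(p-1) and p, multiplied by p; it is also
    the tangent-line bound for the power p at u. At p = 1 the conjugate exponent degenerates, hence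
    the separate case. *)
Lemma powR_young p u v : 1 <= p -> 0 <= u -> 0 <= v ->
  p * u `^ (p - 1) * v <= (p - 1) * u `^ p + v `^ p.
Proof.
rewrite le_eqVlt => /predU1P[<-|p1] u0 v0.
  by rewrite subrr powRr0 !powRr1// !mul1r mul0r add0r.
have p0 : 0 < p by lra.
have q0 : 0 < p / (p - 1) by rewrite divr_gt0//; lra.
have := @conjugate_powR R (u `^ (p - 1)) v _ p (powR_ge0 _ _) v0 q0 p0.
rewrite -powRrM mulrCA divff ?mulr1; last by lra.
have pq : (p / (p - 1))^-1 + p^-1 = 1 by field; apply/andP; split; lra.
move=> /(_ pq); rewrite -mulrA -(ler_pM2l p0) => /le_trans; apply.
by rewrite le_eqVlt; apply/orP; left; apply/eqP; field; apply/andP; split; lra.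
Qed.

(** Young's inequality with exponent 1/a, for 1 and t^a. *)
Lemma powR_bernoulli a t : 0 < a <= 1 -> 0 <= t -> t `^ a <= a * t + (1 - a).
Proof.
move=> /andP[a0 a1] t0.
have ia1 : 1 <= a^-1 by rewrite invf_ge1.
have := powR_young ia1 ler01 (powR_ge0 t a).
rewrite !powR1 !mulr1 -powRrM divff ?powRr1//; last by lra.
rewrite -(ler_pM2l a0) mulrA divff ?mul1r; last by lra.
by move/le_trans; apply; rewrite mulrDr mulrBr divff ?mulr1; lra.
Qed.

(** Bernoulli's inequality at z/m is the tangent bound at the mean [m]; averaging it over x and y
    leaves exactly m^a. If the mean vanishes, so do both weighted terms. *)
Lemma powR_concave a t x y : 0 < a <= 1 -> 0 <= t <= 1 -> 0 <= x -> 0 <= y ->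
  t * x `^ a + (1 - t) * y `^ a <= (t * x + (1 - t) * y) `^ a.
Proof.
move=> a01 /andP[t0 t1] x0 y0; have /andP[a0 a1] := a01.
set m := t * x + (1 - t) * y.
have m0 : 0 <= m by rewrite addr_ge0// mulr_ge0//; lra.
have tangent z : 0 <= z -> m != 0 ->
    z `^ a <= m `^ a * (a * (z / m) + (1 - a)).
  move=> z0 mN0; have mp : 0 < m by rewrite lt_neqAle eq_sym mN0.
  rewrite -{1}(divfK mN0 z) mulrC powRM//; last by rewrite divr_ge0.
  by rewrite ler_wpM2l ?powR_ge0// powR_bernoulli// divr_ge0.
have [m00|mN0] := eqVneq m 0.
  have := mulr_ge0 t0 x0; have s0 : 0 <= 1 - t by lra.
  have := mulr_ge0 s0 y0; rewrite /m in m00 => sy tx.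
  have /eqP : t * x = 0 by lra.
  have /eqP : (1 - t) * y = 0 by lra.
  rewrite !mulf_eq0 => h1 h2.
  have -> : t * x `^ a = 0.
    by case/orP: h2 => /eqP ->; rewrite ?mul0r// powR0 ?mulr0//; lra.
  have -> : (1 - t) * y `^ a = 0.
    by case/orP: h1 => /eqP ->; rewrite ?mul0r// powR0 ?mulr0//; lra.
  by rewrite addr0 powR_ge0.
have s0 : 0 <= 1 - t by lra.
have := ler_wpM2l t0 (tangent _ x0 mN0).
have := ler_wpM2l s0 (tangent _ y0 mN0).
move=> h1 h2; apply: le_trans (lerD h2 h1) _.
rewrite le_eqVlt; apply/orP; left; apply/eqP.
rewrite [RHS](_ : _ = m `^ a * (a * (m / m) + (1 - a))); last first.
  by rewrite divff// mulr1 addrC subrK mulr1.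
by rewrite [in RHS](_ : m / m = (t * x + (1 - t) * y) / m)//; field.
Qed.

(** For 0 <= z <= s = x + y one has (z/s)^a >= z/s; add the cases z = x and z = y. *)
Lemma powR_subadditive a x y : 0 < a <= 1 -> 0 <= x -> 0 <= y ->
  (x + y) `^ a <= x `^ a + y `^ a.
Proof.
move=> /andP[a0 a1] x0 y0; set s := x + y.
have s0 : 0 <= s by rewrite addr_ge0.
have [s00|sN0] := eqVneq s 0.
  by rewrite s00 powR0 ?addr_ge0 ?powR_ge0//; lra.
have sp : 0 < s by rewrite lt_neqAle eq_sym sN0.
have sub z : 0 <= z -> z <= s -> s `^ a * (z / s) <= z `^ a.
  rewrite le_eqVlt => /predU1P[<- _|z0 zs].
    by rewrite mul0r mulr0 powR_ge0.
  rewrite mulrC -{2}(divfK sN0 z) powRM ?divr_ge0 ?(ltW z0)//.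
  rewrite ler_wpM2r ?powR_ge0// ger1_powR// divr_gt0//=.
  by rewrite ler_pdivrMr// mul1r.
have xs : x <= s by rewrite lerDl.
have ys : y <= s by rewrite lerDr.
apply: le_trans (lerD (sub _ x0 xs) (sub _ y0 ys)).
by rewrite -mulrDr -mulrDl divff// mulr1.
Qed.

(** Concavity at the midpoint; the constant arises as 2 * 2^(-a). *)
Lemma powR_sum_le a x y : 0 < a <= 1 -> 0 <= x -> 0 <= y ->
  x `^ a + y `^ a <= 2 `^ (1 - a) * (x + y) `^ a.
Proof.
move=> a01 x0 y0; have /andP[a0 a1] := a01.
have h : 0 <= (2^-1 : R) <= 1 by lra.
have := powR_concave a01 h x0 y0.
have -> : 1 - 2^-1 = 2^-1 :> R by lra.
rewrite -!mulrDr powRM ?addr_ge0// -{2}(powR_inv1 (ler0n R 2)) -powRrM mulN1r.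
move=> {}h; have := ler_wpM2l (ler0n R 2) h.
rewrite mulrA divff// mul1r => /le_trans; apply.
by rewrite mulrA powRB ?powRr1// ?powRN// pnatr_eq0 implybT.
Qed.

Lemma powRV p x : 0 <= x -> x^-1 `^ p = (x `^ p)^-1.
Proof. by move=> x0; rewrite -(powR_inv1 x0) powRAC powR_inv1// powR_ge0. Qed.

Lemma powR_sqr a x : 0 <= x -> (x ^+ 2) `^ a = (x `^ a) ^+ 2.
Proof. by move=> x0; rewrite !expr2 powRM. Qed.

Lemma powR1D a x : 0 <= x -> 0 < a -> x `^ (1 + a) = x * x `^ a.
Proof.
move=> x0 a0; rewrite -(@mulr_powRB1 _ _ (1 + a))//; last by lra.
by congr (_ * _ `^ _); ring.
Qed.

Lemma powR_dist_le a x y : 0 < a <= 1 -> 0 <= x -> 0 <= y ->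
  `|x `^ a - y `^ a| <= `|x - y| `^ a.
Proof.
move=> a01; have /andP[a0 a1] := a01.
wlog yx : x y / y <= x.
  move=> H x0 y0; have [|xy] := leP y x; first by move/H; exact.
  by rewrite distrC (distrC x); apply: H => //; exact: ltW.
move=> x0 y0; rewrite ger0_norm ?subr_ge0 ?ler_powRl ?(ltW a0)//.
rewrite ger0_norm ?subr_ge0// lerBlDl.
have xy0 : 0 <= x - y by rewrite subr_ge0.
by have := powR_subadditive a01 y0 xy0; rewrite subrKC.
Qed.

Lemma ler_add_divn x y t : (forall n : nat, x <= y + t / n.+1%:R) -> x <= y.
Proof.
move=> h; apply/ler_addgt0Pr => e e0.
have [t0|t0] := leP t 0.
  have := h 0%N; rewrite divr1 => /le_trans; apply.
  by rewrite lerD2l (le_trans t0)// ltW.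
have te : 0 <= t / e by rewrite divr_ge0 // ltW.
have := archi_boundP te; set n := Num.bound _ => nte.
apply: le_trans (h n) _; rewrite lerD2l ler_pdivrMr//.
rewrite mulrC -ler_pdivrMr// (le_trans (ltW nte))// ler_nat; exact: leqnSn.
Qed.

(** Turns a limit t -> 0 in an error term of order t^a into the choice of one t. *)
Lemma powR_small a (C e : R) : 0 < a -> 0 < e ->
  exists2 t, 0 < t & C * t `^ a <= e.
Proof.
move=> a0 e0; have C0 : 0 < `|C| + 1 by rewrite ltr_wpDl.
exists ((e / (`|C| + 1)) `^ a^-1); first by rewrite powR_gt0// divr_gt0.
rewrite -powRrM mulVf ?gt_eqF// powRr1 ?divr_ge0 ?(ltW e0) ?(ltW C0)//.
rewrite mulrA ler_pdivrMr// mulrC ler_wpM2l ?(ltW e0)//.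
by rewrite (le_trans (ler_norm _))// lerDl.
Qed.

End powR_inequalities.

(** * Inner products and the power of the norm *)

Section inner_product_lemmas.
Variables (R : realType) (X : normedModType R).
Variable dot : {dot X for idfun}.
Hypothesis dot_norm : forall x : X, dot x x = `|x| ^+ 2.
Implicit Types (x y z u v h : X) (a : R).

Lemma dotDl x y z : dot (x + y) z = dot x z + dot y z.
Proof. exact: linearDl. Qed.
Lemma dotDr x y z : dot x (y + z) = dot x y + dot x z.
Proof. exact: linearDr. Qed.
Lemma dotNl x y : dot (- x) y = - dot x y.
Proof. exact: linearNl. Qed.
Lemma dotNr x y : dot x (- y) = - dot x y.
Proof. exact: linearNr. Qed.
Lemma dotZl t x y : dot (t *: x) y = t * dot x y.
Proof. exact: linearZl_LR. Qed.
Lemma dotZr t x y : dot x (t *: y) = t * dot x y.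
Proof. exact: linearZr_LR. Qed.
Lemma dotBl x y z : dot (x - y) z = dot x z - dot y z.
Proof. by rewrite dotDl dotNl. Qed.
Lemma dotBr x y z : dot x (y - z) = dot x y - dot x z.
Proof. by rewrite dotDr dotNr. Qed.
Lemma dot0r x : dot x 0 = 0.
Proof. exact: linear0r. Qed.

Lemma dotC x y : dot x y = dot y x.
Proof. by rewrite hermC expr0 mul1r. Qed.

Lemma normD_sqr x y : `|x + y| ^+ 2 = `|x| ^+ 2 + 2 * dot x y + `|y| ^+ 2.
Proof. by rewrite -!dot_norm !dotDl !dotDr (dotC y x); ring. Qed.

Lemma normB_sqr x y : `|x - y| ^+ 2 = `|x| ^+ 2 - 2 * dot x y + `|y| ^+ 2.
Proof. by rewrite normD_sqr dotNr normrN mulrN. Qed.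

(** Cauchy-Schwarz, read off the squared triangle inequality. *)
Lemma dot_le x y : dot x y <= `|x| * `|y|.
Proof.
have := lerXn2r 2 (normr_ge0 (x + y)) (addr_ge0 (normr_ge0 x) (normr_ge0 y)).
by move=> /(_ (ler_normD _ _)); rewrite normD_sqr sqrrD -mulr_natl; lra.
Qed.

Lemma dot_ge x y : - (`|x| * `|y|) <= dot x y.
Proof. by have := dot_le x (- y); rewrite normrN dotNr; lra. Qed.

Lemma dot_inj u v : (forall h, dot u h = dot v h) -> u = v.
Proof.
move=> uv; apply/eqP; rewrite -subr_eq0 -normr_eq0 -sqrf_eq0 -dot_norm dotBl.
by rewrite uv subrr.
Qed.

(** Up to the factor 1 + a, the gradient of |u|^(1+a). At u = 0 the scalar has a conventional value,
    but the vector is 0. *)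
Definition powR_grad a u : X := `|u| `^ (a - 1) *: u.

Lemma dot_powR_grad a u v :
  dot (powR_grad a u) v = `|u| `^ (a - 1) * dot u v.
Proof. exact: dotZl. Qed.

Lemma norm_powR_grad a u : 0 < a -> `|powR_grad a u| = `|u| `^ a.
Proof.
move=> a0; rewrite normrZ ger0_norm ?powR_ge0// mulrC mulr_powRB1//.
Qed.

(* For fixed norms of [u] and [v], the squared left side is affine in
   [dot u v] and the squared right side concave, so the collinear cases
   (th = 0 and th = 1 below) suffice. *)
Lemma powR_grad_hoelder a u v : 0 < a <= 1 ->
  `|powR_grad a u - powR_grad a v| <= 2 `^ (1 - a) * `|u - v| `^ a.
Proof.
move=> a01; have /andP[a0 a1] := a01.
have K1 : 1 <= 2 `^ (1 - a).
  by rewrite -[leLHS](powRr0 2) ler_powR ?ler1n// subr_ge0.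
have K0 : 0 <= 2 `^ (1 - a) :> R by exact: powR_ge0.
have J0 : powR_grad a 0 = 0 by rewrite /powR_grad scaler0.
have [->|u0] := eqVneq u 0.
  by rewrite J0 !sub0r !normrN norm_powR_grad// ler_peMl// powR_ge0.
have [->|v0] := eqVneq v 0.
  by rewrite J0 !subr0 norm_powR_grad// ler_peMl// powR_ge0.
have r0 : 0 < `|u| by rewrite normr_gt0.
have s0 : 0 < `|v| by rewrite normr_gt0.
rewrite -ler_sqr ?nnegrE ?mulr_ge0 ?powR_ge0//.
rewrite normB_sqr dot_powR_grad dotC dot_powR_grad dotC !norm_powR_grad//.
rewrite exprMn -[X in _ <= _ * X]powR_sqr// normB_sqr.
have := dot_le u v; have := dot_ge u v.
move: (dot u v) => c cl cu.
have hr := mulr_powRB1 (ltW r0) a0.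
have hs := mulr_powRB1 (ltW s0) a0.
have ha := powR_dist_le a01 (ltW r0) (ltW s0).
have hb := powR_sum_le a01 (ltW r0) (ltW s0).
move: `|u| `|v| r0 s0 cl cu hr hs ha hb => r s r0 s0 cl cu hr hs ha hb.
(* [th] is the weight writing [c] as (1 - th) r s + th (- r s), a mixture of the parallel and the
   opposite case. *)
pose th : R := (1 - c / (r * s)) / 2.
have rs0 : 0 < r * s by rewrite mulr_gt0.
have ec : c = (1 - 2 * th) * (r * s).
  by rewrite /th; field; rewrite !gt_eqF.
have th01 : 0 <= th <= 1.
  have h1 : c / (r * s) <= 1 by rewrite ler_pdivrMr// mul1r.
  have h2 : -1 <= c / (r * s) by rewrite ler_pdivlMr// mulN1r.
  by rewrite /th; apply/andP; split; lra.
have e1 : r ^+ 2 - 2 * c + s ^+ 2 =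
    th * (r + s) ^+ 2 + (1 - th) * `|r - s| ^+ 2.
  by rewrite ec real_normK ?num_real//; ring.
have /andP[t0 t1] := th01.
rewrite e1; apply: le_trans (ler_wpM2l _ (powR_concave a01 th01 _ _));
  last 3 first.
- by rewrite exprn_ge0.
- by rewrite exprn_ge0// addr_ge0// ltW.
- by rewrite exprn_ge0.
rewrite (_ : r `^ a ^+ 2 - _ + _ =
  th * (r `^ a + s `^ a) ^+ 2 + (1 - th) * (r `^ a - s `^ a) ^+ 2); last first.
  by rewrite ec -hr -hs; ring.
rewrite mulrDr lerD//.
  rewrite [leRHS]mulrCA ler_wpM2l// powR_sqr ?addr_ge0 ?(ltW r0) ?(ltW s0)//.
  by rewrite -exprMn lerXn2r// nnegrE ?addr_ge0 ?mulr_ge0 ?powR_ge0.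
(* In the parallel case the constant 1 already works, and 2^(1-a) >= 1. *)
rewrite [leRHS]mulrCA ler_wpM2l ?subr_ge0// powR_sqr//.
rewrite -(real_normK (num_real (r `^ a - s `^ a))) -[leLHS]mul1r ler_pM//.
- by rewrite exprn_ege1.
- by rewrite lerXn2r// nnegrE powR_ge0.
Qed.

(** Young's inequality for the norms, after Cauchy-Schwarz bounds the mixed term by |u|^a |v|. *)
Lemma powR_norm_subgradient a u v : 0 < a ->
  `|u| `^ (1 + a) + (1 + a) * dot (powR_grad a u) (v - u) <= `|v| `^ (1 + a).
Proof.
move=> a0; have a10 : 1 <= 1 + a by lra.
have := powR_young a10 (normr_ge0 u) (normr_ge0 v).
have -> : 1 + a - 1 = a by ring.
rewrite dotBr !dot_powR_grad dot_norm.
have := ler_wpM2l (powR_ge0 `|u| (a - 1)) (dot_le u v).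
have -> : `|u| `^ (a - 1) * (`|u| * `|v|) = `|u| `^ a * `|v|.
  by rewrite mulrA (mulrC _ `|u|) mulr_powRB1.
have -> : `|u| `^ (a - 1) * `|u| ^+ 2 = `|u| `^ (1 + a).
  by rewrite expr2 mulrA (mulrC (_ `^ _)) mulr_powRB1// mulrC powR1D.
nra.
Qed.

(* Summing the subgradient inequality at [x + j e], [j = 1 .. k]; the sum of
   the [j `^ a] is at most [k `^ (1 + a) / (1 + a) + k `^ a]. *)
Lemma powR_norm_steps a x h (k : nat) : 0 < a <= 1 ->
  `|x + k%:R *: h| `^ (1 + a) <=
    `|x| `^ (1 + a) + (1 + a) * k%:R * dot (powR_grad a x) h
    + (1 + a) * 2 `^ (1 - a) * `|h| `^ (1 + a) *
      (k%:R `^ (1 + a) / (1 + a) + k%:R `^ a).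
Proof.
move=> a01; have /andP[a0 a1] := a01.
have a10 : 0 < 1 + a by lra.
elim: k => [|k IH].
  by rewrite scale0r addr0 !powR0 ?gt_eqF// mul0r addr0 !(mulr0, mul0r) !addr0.
set u := x + k.+1%:R *: h.
have := powR_norm_subgradient u (x + k%:R *: h) a0.
have -> : x + k%:R *: h - u = - h.
  rewrite /u -addn1 natrD scalerDl scale1r !opprD addrACA subrr add0r.
  by rewrite addrA subrr add0r.
rewrite dotNr => step.
(* The gradient at [u] is traded for the one at [x]; the two points differ by (k+1) h. *)
have hold : dot (powR_grad a u) h <=
    dot (powR_grad a x) h + 2 `^ (1 - a) * k.+1%:R `^ a * `|h| `^ (1 + a).
  rewrite -lerBlDl -dotBl; apply: le_trans (dot_le _ _) _.
  have := powR_grad_hoelder u x a01.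
  rewrite /u (addrC x) addrK normrZ normr_nat powRM//.
  move=> /(ler_wpM2r (normr_ge0 h))/le_trans; apply; rewrite -!mulrA.
  do 2 (apply: ler_wpM2l; first exact: powR_ge0).
  by rewrite powR1D// mulrC.
(* The tangent to t^(1+a) at k, evaluated at k + 1: a discrete form of integrating t^a. *)
have a11 : 1 <= 1 + a by lra.
have := powR_young a11 (ler0n R k) (ler0n R k.+1).
have -> : 1 + a - 1 = a by ring.
have kE : k%:R * k%:R `^ a = k%:R `^ (1 + a).
  by rewrite powR1D.
have k1E : k.+1%:R = k%:R + 1 :> R by rewrite -addn1 natrD.
rewrite [X in _ * _ * X <= _]k1E => young.
have {}young : k%:R `^ (1 + a) / (1 + a) + k%:R `^ a <=
    k.+1%:R `^ (1 + a) / (1 + a).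
  rewrite -(ler_pM2l a10) mulrDr !(mulrC _ (_ / _)) !divfK ?gt_eqF//.
  by move: young kE; nra.
have P0 : 0 <= (1 + a) * 2 `^ (1 - a) * `|h| `^ (1 + a).
  by rewrite !mulr_ge0 ?powR_ge0// ltW.
have {young} := ler_wpM2l P0 young.
have {hold} := ler_wpM2l (ltW a10) hold.
rewrite k1E; move: IH step; move: (`|_ + _| `^ _) (`|u| `^ _) (_ / _) (_ / _).
move: (dot _ _) (dot _ _) (_ `^ _) (_ `^ _) (_ `^ _) (_ `^ _) (_ `^ _) => *.
lra.
Qed.

(** Cutting h into n + 1 equal steps replaces the integral of the gradient along the segment: the
    main error is 2^(1-a) |h|^(1+a) for every n, and the rest is O(1/n). *)
Lemma powR_norm_upper a x h : 0 < a <= 1 ->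
  `|x + h| `^ (1 + a) <= `|x| `^ (1 + a) + (1 + a) * dot (powR_grad a x) h
    + 2 `^ (1 - a) * `|h| `^ (1 + a).
Proof.
move=> a01; have /andP[a0 a1] := a01; have a10 : 0 < 1 + a by lra.
apply: (@ler_add_divn _ _ _ ((1 + a) * 2 `^ (1 - a) * `|h| `^ (1 + a))) => n.
have n0 : n.+1%:R != 0 :> R by rewrite pnatr_eq0.
have := powR_norm_steps x (n.+1%:R^-1 *: h) n.+1 a01.
rewrite scalerA divff// scale1r => /le_trans; apply.
rewrite dotZr normrZ ger0_norm ?invr_ge0// powRM ?invr_ge0//.
have -> : n.+1%:R^-1 `^ (1 + a) = (n.+1%:R `^ a)^-1 / n.+1%:R :> R.
  have iE : n.+1%:R^-1 = n.+1%:R `^ (-1) :> R by rewrite powR_inv1.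
  by rewrite {1}iE powRAC powR_inv1 ?powR_ge0// powR1D// invfM mulrC.
rewrite (powR1D (ler0n _ n.+1))//.
rewrite le_eqVlt; apply/orP; left; apply/eqP; field.
by rewrite nat1r n0 (gt_eqF a10) powR_eq0 (negPf n0).
Qed.

(* The first-order terms at [- (e *: k)] and [k] cancel. *)
Lemma powR_norm_combination a e x k : 0 < a <= 1 -> 0 < e ->
  `|x - e *: k| `^ (1 + a) + e * `|x + k| `^ (1 + a) <=
    (1 + e) * `|x| `^ (1 + a)
    + 2 `^ (1 - a) * (e + e `^ (1 + a)) * `|k| `^ (1 + a).
Proof.
move=> a01 e0.
have h1 := powR_norm_upper x (- (e *: k)) a01.
have := ler_wpM2l (ltW e0) (powR_norm_upper x k a01).
move: h1; rewrite normrN normrZ (ger0_norm (ltW e0)) powRM ?(ltW e0)//.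
by rewrite dotNr dotZr; lra.
Qed.

End inner_product_lemmas.

(** * Riesz representation and gradients *)

Section riesz.
Variables (R : realType) (X : completeNormedModType R).
Variable dot : {dot X for idfun}.
Hypothesis dot_norm : forall x : X, dot x x = `|x| ^+ 2.

(* The representing vector minimizes [`|v| ^+ 2 - 2 * D v]; minimizing
   sequences are Cauchy by the parallelogram identity. *)
Lemma riesz_representation (D : X -> R) (C : R) :
  (forall x y, D (x + y) = D x + D y) -> (forall t x, D (t *: x) = t * D x) ->
  (forall x, D x <= C * `|x|) ->
  exists v, forall h, D h = dot v h.
Proof.
move=> DD DZ DC; pose J v := `|v| ^+ 2 - 2 * D v.
have Jge v : - C ^+ 2 <= J v.
  by have := DC v; have := sqr_ge0 (`|v| - C); rewrite /J; nra.
have Jinf : has_inf (range J).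
  split; first by exists (J 0); exists 0.
  by exists (- C ^+ 2) => _ [v _ <-].
pose m := inf (range J).
have mJ v : m <= J v by apply: (ge_inf Jinf.2); exists v.
(* Compare with the value of [J] at the midpoint, which is at least [m]. *)
have parallelogram u v (e : R) : J u <= m + e -> J v <= m + e ->
    `|u - v| ^+ 2 <= 4 * e.
  move=> Ju Jv; have := mJ (2^-1 *: (u + v)).
  move: Ju Jv; rewrite /J DZ DD normrZ ger0_norm// exprMn.
  rewrite (normD_sqr dot_norm) (normB_sqr dot_norm); lra.
have near_min (n : nat) : exists v, J v <= m + n.+1%:R^-1.
  have [|_ [v _ <-] h] := @inf_adherent _ _ n.+1%:R^-1 _ Jinf.
    by rewrite invr_gt0.
  by exists v; exact: ltW.
have [u uP] := choice near_min.
have ule N n : (N <= n)%N -> J (u n) <= m + N.+1%:R^-1.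
  move=> Nn; apply: le_trans (uP n) _.
  by rewrite lerD2l lef_pV2 ?posrE// ler_nat.
have small (e : R) : 0 < e -> exists N, N.+1%:R^-1 < e.
  move=> e0; have ie0 : 0 <= e^-1 by rewrite invr_ge0 ltW.
  have h := archi_boundP ie0.
  exists (Num.bound e^-1); rewrite invf_plt ?posrE// (lt_le_trans h)// ler_nat.
  exact: leqnSn.
have ucauchy : cauchy (u @ \oo).
  apply: cauchy_exP => e e0.
  have e40 : 0 < e ^+ 2 / 4 by rewrite divr_gt0// exprn_gt0.
  have [N hN] := small _ e40.
  exists (u N), N => // n /= Nn; rewrite -ball_normE /=.
  rewrite -(@ltr_pXn2r _ 2)// ?nnegrE ?(ltW e0)//.
  apply: le_lt_trans (parallelogram _ _ _ (ule N N (leqnn _)) (ule N n Nn)) _.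
  by rewrite mulrC -ltr_pdivlMr.
have /cvg_ex[v uv] : cvg (u @ \oo) by apply/cauchy_cvgP.
exists v => h; apply/eqP; rewrite eq_sym -subr_eq0; apply/eqP.
set q := _ - _.
(* This is J(v) <= J(v + t h), expanded. Values of [J] are compared at [u n], and only the inner
   product is passed to the limit; the two errors, each at most [d], add up to at most [e]. *)
have quad (t : R) : 0 <= 2 * t * q + t ^+ 2 * `|h| ^+ 2.
  apply/ler_addgt0Pr => e e0.
  pose d := e / (2 * `|t| * `|h| + 1).
  have c0 : 0 <= 2 * `|t| * `|h| by rewrite !mulr_ge0.
  have d0 : 0 < d by rewrite divr_gt0//; lra.
  have [N hN] := small _ d0.
  have /cvgrPdist_le/(_ _ d0)[N' _ hN'] := uv.
  pose n := maxn N N'; have /= hv := hN' n (leq_maxr _ _).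
  have Ju := ule N n (leq_maxl _ _).
  have := mJ (u n + t *: h).
  have : 2 * t * (dot (u n) h - dot v h) <= 2 * `|t| * `|h| * d.
    have : t * (dot (u n) h - dot v h) <= `|t| * (d * `|h|).
      apply: (le_trans (ler_norm _)); rewrite normrM ler_wpM2l//.
      apply: (@le_trans _ _ (`|u n - v| * `|h|)).
        by rewrite -dotBl ler_norml (dot_ge dot_norm) (dot_le dot_norm).
      by rewrite ler_wpM2r// distrC.
    by lra.
  move: Ju; rewrite /J DD DZ (normD_sqr dot_norm) dotZr normrZ exprMn.
  rewrite real_normK ?num_real// /q.
  have : d * (2 * `|t| * `|h| + 1) = e by rewrite /d divfK//; lra.
  by move: (N.+1%:R^-1) hN => r; rewrite /q; lra.
(* Nearly the minimizer of the quadratic in t; the [+ 1] keeps the denominator nonzero when h =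
   0. *)
have := quad (- q / (`|h| ^+ 2 + 1)).
have N0 : 0 <= `|h| ^+ 2 by rewrite exprn_ge0.
move: (`|h| ^+ 2) N0 => N N0.
have -> : 2 * (- q / (N + 1)) * q + (- q / (N + 1)) ^+ 2 * N =
    - (q / (N + 1)) ^+ 2 * (N + 2) by field; lra.
rewrite mulNr oppr_ge0 => h1; apply/eqP.
have : (q / (N + 1)) ^+ 2 == 0.
  by rewrite eq_le sqr_ge0 andbT; have := sqr_ge0 (q / (N + 1)); nra.
by rewrite sqrf_eq0 mulf_eq0 invr_eq0 [N + 1 == 0]gt_eqF ?orbF//; lra.
Qed.

End riesz.

(** * Gradients and first-order expansions *)

Section gradient.
Variables (R : realType) (X : completeNormedModType R).
Variable dot : {dot X for idfun}.
Hypothesis dot_norm : forall x : X, dot x x = `|x| ^+ 2.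
Implicit Types (F : X -> R^o) (x v h : X).

Lemma dot_continuous v : continuous (dot v : X -> R^o).
Proof.
apply: bounded_linear_continuous; apply/linear_boundedP; near=> r => x.
apply: (@le_trans _ _ (`|v| * `|x|)).
  by rewrite ler_norml (dot_ge dot_norm) (dot_le dot_norm).
by rewrite ler_wpM2r//; near: r; apply: nbhs_pinfty_ge; exact: num_real.
Unshelve. all: by end_near. Qed.

Lemma gradient_unique F x v : (forall h, 'd F x h = dot v h) ->
  gradient dot F x = v.
Proof.
move=> h; rewrite /gradient; case: xgetP => [w _ wP|/(_ v)//].
by apply: (dot_inj dot_norm) => k; rewrite -wP h.
Qed.

(** The derivative is continuous and linear, hence bounded, so Riesz supplies the vector that [xget]
    selects. *)
Lemma diff_gradient F x h : differentiable F x ->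
  'd F x h = dot (gradient dot F x) h.
Proof.
move=> dF; suff [v vP] : exists v, forall k, 'd F x k = dot v k.
  by rewrite (gradient_unique vP) vP.
have /linear_bounded_continuous/linear_boundedP : continuous ('d F x).
  exact: diff_continuous.
move=> /pinfty_ex_gt0[C C0 hC].
apply: (riesz_representation dot_norm (C := C)).
- by move=> y z; rewrite linearD.
- by move=> t y; rewrite linearZ.
- by move=> y; apply: le_trans (hC y); exact: ler_norm.
Qed.

(** A remainder of order |h|^(1+a) is o(|h|), so [dot v] is the derivative, and its representing
    vector is unique. *)
Lemma gradient_of_expansion F x v (K a : R) : 0 < a ->
  (forall h, `|F (x + h) - F x - dot v h| <= K * `|h| `^ (1 + a)) ->
  differentiable F x /\ gradient dot F x = v.
Proof.
move=> a0 FK.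
have dv : F \o shift x = cst (F x) + (dot v : X -> R^o) +o_ 0 id.
  apply/eqaddoP => /= e e0.
  pose K' : R := `|K| + 1; have K0 : 0 < K' by rewrite ltr_wpDl.
  pose d := (e / K') `^ a^-1.
  have d0 : 0 < d by rewrite powR_gt0// divr_gt0.
  apply/nbhs_norm0P; exists d => //= h hd.
  have -> : (F \o +%R^~ x - (cst (F x) + (dot v : X -> R^o))) h =
      F (x + h) - F x - dot v h.
    by rewrite [in RHS](addrC x) -addrA -opprD.
  apply: le_trans (FK h) _; rewrite powR1D// mulrCA mulrC.
  rewrite ler_wpM2r// (@le_trans _ _ (K' * `|h| `^ a))//.
    by rewrite ler_wpM2r ?powR_ge0// (le_trans (ler_norm _))// lerDl.
  rewrite mulrC -ler_pdivlMr//.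
  have -> : e / K' = d `^ a.
    by rewrite /d -powRrM mulVf ?gt_eqF// powRr1// divr_ge0 ?ltW.
  by apply: ler_powRl => //; exact: ltW.
have dvc : continuous (dot v : X -> R^o) by exact: dot_continuous.
have dE := diff_unique dvc dv.
split; last by apply: gradient_unique => h; rewrite dE.
apply/diff_locallyP; rewrite dE; split; [exact: dvc|exact: dv].
Qed.

End gradient.

(** * Convex functions *)

Section convex_functions.
Variables (R : realType) (X : normedModType R).
Implicit Types (F : X -> R^o) (x h k : X) (t e : R).

Lemma convex_functionP F :
  convex_function (setT : set (convex_lmodType X)) F <->
  forall t x y, 0 <= t <= 1 ->
    F (t *: x + (1 - t) *: y) <= t * F x + (1 - t) * F y.
Proof.
split=> [cF t x y /andP[t0 t1]|cF t x y _ _]; last first.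
  by apply: (cF t%:num x y); rewrite ge0 le1.
by have := cF (Itv01 t0 t1) x y; rewrite !inE => /(_ I I).
Qed.

(** Inherited by every smaller function: this is how the convex envelopes obtain it from
    [envelope]. *)
Definition locally_bounded_above F :=
  forall x, exists B : R, forall h, `|h| <= 1 -> F (x + h) <= B.

Variable F : X -> R^o.
Hypothesis cF : convex_function (setT : set (convex_lmodType X)) F.

Let cvxF t x y : 0 <= t <= 1 ->
    F (t *: x + (1 - t) *: y) <= t * F x + (1 - t) * F y.
Proof. exact: (convex_functionP F).1 cF t x y. Qed.

Lemma convex_midpoint x h : 2 * F x <= F (x + h) + F (x - h).
Proof.
have h2 : 0 <= (2^-1 : R) <= 1 by lra.
have := cvxF (x + h) (x - h) h2.
have -> : 2^-1 *: (x + h) + (1 - 2^-1) *: (x - h) = x.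
  have -> : 1 - 2^-1 = 2^-1 :> R by lra.
  rewrite -scalerDr addrACA subrr addr0 -mulr2n -(scaler_nat 2 x) scalerA.
  by rewrite mulVf// scale1r.
lra.
Qed.

Lemma convex_segment t x h : 0 <= t <= 1 ->
  F (x + t *: h) <= F x + t * (F (x + h) - F x).
Proof.
move=> t01; have := cvxF (x + h) x t01.
rewrite scalerDr addrAC -scalerDl subrKC scale1r; lra.
Qed.

(** The bound on the unit ball controls increments from above by |h| (B - F x); midpoint convexity
    reflects this into a lower bound. *)
Lemma convex_bounded_continuous : locally_bounded_above F -> continuous F.
Proof.
move=> Fb x; have [B FB] := Fb x.
have B0 : F x <= B by have := FB 0; rewrite normr0 addr0; apply.
have main h : `|h| <= 1 -> F (x + h) - F x <= `|h| * (B - F x).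
  move=> h1; have [->|h0] := eqVneq h 0.
    by rewrite addr0 subrr normr0 mul0r.
  have hp : 0 < `|h| by rewrite normr_gt0.
  have hh : 0 <= `|h| <= 1 by rewrite normr_ge0.
  have := convex_segment x (`|h|^-1 *: h) hh.
  rewrite scalerA divff ?gt_eqF// scale1r.
  have /FB : `| (`|h|^-1 *: h) | <= 1.
    by rewrite normrZ ger0_norm ?invr_ge0// mulVf ?gt_eqF.
  by move=> h2; move: (ler_wpM2l (ltW hp) h2); lra.
apply/cvgrPdist_le => /= e e0.
pose d := Num.min 1 (e / (B - F x + 1)).
have C0 : 0 < B - F x + 1 by lra.
have d0 : 0 < d by rewrite lt_min ltr01 divr_gt0.
apply/nbhs_normP; exists d => //= y; rewrite /= lt_min => /andP[y1 ye].
have xy1 : `|y - x| <= 1 by rewrite distrC ltW.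
have xye : `|y - x| * (B - F x) <= e.
  apply: (@le_trans _ _ (`|y - x| * (B - F x + 1))).
    by rewrite ler_wpM2l// lerDl.
  by rewrite -ler_pdivlMr// distrC ltW.
have := main (y - x) xy1; rewrite subrKC.
have := main (- (y - x)); rewrite normrN => /(_ xy1).
have := convex_midpoint x (y - x); rewrite subrKC ler_norml.
by move=> *; apply/andP; split; lra.
Qed.

End convex_functions.

(** * Directional derivatives and subgradients of convex functions *)

Section subgradient.
Variables (R : realType) (X : completeNormedModType R).
Variable dot : {dot X for idfun}.
Hypothesis dot_norm : forall x : X, dot x x = `|x| ^+ 2.
Implicit Types (x h k : X) (t e : R).
Variables (F : X -> R^o) (x : X) (a K : R).
Hypothesis cF : convex_function (setT : set (convex_lmodType X)) F.
Hypothesis Fb : locally_bounded_above F.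
Hypothesis a_gt0 : 0 < a.
Hypothesis F2 : forall h,
  F (x + h) + F (x - h) - 2 * F x <= K * `|h| `^ (1 + a).

(** Since [q] is monotone in t, its infimum [D] is the one-sided directional derivative at x. *)
Let q t h : R := (F (x + t *: h) - F x) / t.
Let D h : R := inf [set q t h | t in [set t | 0 < t]].

Let q_mono s t h : 0 < s -> s <= t -> q s h <= q t h.
Proof.
move=> s0 st; have t0 : 0 < t by exact: lt_le_trans st.
have st01 : 0 <= s / t <= 1.
  by rewrite divr_ge0 ?(ltW s0) ?(ltW t0)//= ler_pdivrMr// mul1r.
have := convex_segment cF x (t *: h) st01.
rewrite scalerA divfK ?gt_eqF// /q ler_pdivrMr//.
have -> : (F (x + t *: h) - F x) / t * s = s / t * (F (x + t *: h) - F x).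
  by ring.
lra.
Qed.

(** The backward slope over [x - h, x] lies below every forward slope; capping the step at 1 keeps
    the backward point on that segment. *)
Let q_ge t h : 0 < t -> F x - F (x - h) <= q t h.
Proof.
move=> t0; pose s := Num.min t 1.
have s0 : 0 < s by rewrite lt_min t0 ltr01.
have st : s <= t by rewrite ge_min lexx.
apply: le_trans (q_mono h s0 st).
have s01 : 0 <= s <= 1 by rewrite (ltW s0) ge_min lexx orbT.
have := convex_segment cF x (- h) s01.
have := convex_midpoint cF x (s *: h).
rewrite scalerN ler_pdivlMr//; lra.
Qed.

Let q_inf h : has_inf [set q t h | t in [set t | 0 < t]].
Proof.
split; first by exists (q 1 h), 1 => //=; exact: ltr01.
by exists (F x - F (x - h)) => _ [t t0 <-]; exact: q_ge.
Qed.

Let D_le t h : 0 < t -> D h <= q t h.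
Proof. by move=> t0; apply: (ge_inf (q_inf h).2); exists t. Qed.

Let D_ge c h : (forall t, 0 < t -> c <= q t h) -> c <= D h.
Proof.
move=> H; apply: lb_le_inf; first exact: (q_inf h).1.
by move=> _ [t t0 <-]; exact: H.
Qed.

Let D_near e h : 0 < e ->
  exists2 d, 0 < d & forall t, 0 < t -> t <= d -> q t h <= D h + e.
Proof.
move=> e0; have [_ [d d0 <-] qd] := inf_adherent e0 (q_inf h).
exists d => // t t0 td; apply: le_trans (ltW qd); exact: q_mono.
Qed.

(** The point x + t (h + k) is the midpoint of x + 2t h and x + 2t k. *)
Let q_half t h k : 0 < t -> q t (h + k) <= q (2 * t) h + q (2 * t) k.
Proof.
move=> t0; have t20 : 0 < 2 * t by lra.
rewrite /q -mulrDl ler_pdivrMr// invfM.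
have -> : forall A : R, A * (2^-1 / t) * t = A / 2.
  by move=> A; field; rewrite gt_eqF.
have := convex_midpoint cF (x + t *: (h + k)) (t *: (h - k)).
rewrite -!addrA -scalerDr -scalerBr.
have -> : h + k + (h - k) = 2 *: h.
  by rewrite addrACA subrr addr0 scaler_nat mulr2n.
have -> : h + k - (h - k) = 2 *: k.
  by rewrite opprB [h + k]addrC addrACA subrr addr0 scaler_nat mulr2n.
rewrite !scalerA (mulrC t); lra.
Qed.

Let D_add_le h k : D (h + k) <= D h + D k.
Proof.
apply/ler_addgt0Pr => e e0.
have e20 : 0 < e / 2 by lra.
have [d1 d10 h1] := D_near h e20; have [d2 d20 h2] := D_near k e20.
pose t := Num.min d1 d2 / 2.
have m0 : 0 < Num.min d1 d2 by rewrite lt_min d10.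
have t0 : 0 < t by rewrite divr_gt0.
have t2 : 2 * t = Num.min d1 d2 by rewrite /t mulrC divfK.
apply: (le_trans (D_le (h + k) t0)); apply: (le_trans (q_half h k t0)).
have := h1 (2 * t); have := h2 (2 * t).
rewrite t2 => /(_ m0) {}h2 /(_ m0) {}h1.
have m1 : Num.min d1 d2 <= d1 by rewrite ge_min lexx.
have m2 : Num.min d1 d2 <= d2 by rewrite ge_min lexx orbT.
by have := h1 m1; have := h2 m2; lra.
Qed.

Let D0 : D 0 = 0.
Proof.
have q0 t : q t 0 = 0 by rewrite /q scaler0 addr0 subrr mul0r.
apply/eqP; rewrite eq_le D_ge ?andbT; last by move=> t _; rewrite q0.
by have := D_le 0 ltr01; rewrite q0.
Qed.

(** D h + D (- h) is nonnegative by subadditivity, and by [F2] it is at most K |h|^(1+a) t^a for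
    every t > 0. *)
Let D_opp h : D (- h) = - D h.
Proof.
have : 0 <= D h + D (- h) by rewrite -D0 -(subrr h) D_add_le.
suff : D h + D (- h) <= 0 by lra.
apply/ler_addgt0Pr => e e0; rewrite add0r.
have [t t0 te] := powR_small (K * `|h| `^ (1 + a)) a_gt0 e0.
apply: le_trans te; apply: (le_trans (lerD (D_le h t0) (D_le (- h) t0))).
rewrite /q -mulrDl ler_pdivrMr//.
have := F2 (t *: h); rewrite normrZ (ger0_norm (ltW t0)) powRM ?(ltW t0)//.
rewrite (powR1D (ltW t0) a_gt0) scalerN; lra.
Qed.

(** One inequality holds for all positive factors; the factor 1/s gives its converse. *)
Let D_scale_pos s h : 0 < s -> D (s *: h) = s * D h.
Proof.
have le r k : 0 < r -> D (r *: k) <= r * D k.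
  move=> r0; rewrite mulrC -ler_pdivrMr//; apply: D_ge => t t0.
  rewrite ler_pdivrMr//.
  have tr0 : 0 < t / r by rewrite divr_gt0.
  apply: (le_trans (D_le _ tr0)); rewrite /q scalerA divfK ?gt_eqF//.
  by rewrite invf_div mulrCA mulrC mulrAC -mulrA mulrC.
move=> s0; apply/eqP; rewrite eq_le le//=.
have := le s^-1 (s *: h); rewrite invr_gt0 => /(_ s0).
by rewrite scalerA mulVf ?gt_eqF// scale1r mulrC ler_pdivlMr// mulrC.
Qed.

Let D_scale s h : D (s *: h) = s * D h.
Proof.
have [s0|s0|->] := ltrgt0P s; first exact: D_scale_pos.
  rewrite -[s]opprK scaleNr D_opp D_scale_pos ?oppr_gt0//; ring.
by rewrite scale0r mul0r D0.
Qed.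

Let D_add h k : D (h + k) = D h + D k.
Proof.
apply/eqP; rewrite eq_le D_add_le/=.
by have := D_add_le (- h) (- k); rewrite -opprD !D_opp; lra.
Qed.

(** [D] is linear and, by the bound on F over the unit ball, bounded; its Riesz vector is a
    subgradient because D h lies below the quotient at t = 1. *)
Lemma convex_subgradient_exists :
  exists v, forall h, F x + dot v h <= F (x + h).
Proof.
have D1 h : D h <= F (x + h) - F x.
  by have := D_le h ltr01; rewrite /q scale1r divr1.
have [B FB] := Fb x.
have [|v Dv] := @riesz_representation _ _ _ dot_norm D (B - F x) D_add D_scale.
  move=> h; have [->|h0] := eqVneq h 0; first by rewrite D0 normr0 mulr0.
  have hp : 0 < `|h| by rewrite normr_gt0.
  rewrite -ler_pdivrMr// mulrC -D_scale.
  apply: (le_trans (D1 _)); rewrite lerD2r FB// normrZ ger0_norm ?invr_ge0//.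
  by rewrite mulVf ?gt_eqF.
by exists v => h; rewrite -Dv; have := D1 h; lra.
Qed.

End subgradient.

(* A derivative-free form of one-sided smoothness: when [F] is differentiable,
   dividing by [e] and letting [e -> 0] bounds the first-order remainder of
   [F] at [x] in the direction [k] by [K * `|k| `^ (1 + a)]. *)
Definition upper_smooth (R : realType) (X : normedModType R) (a K : R)
    (F : X -> R^o) :=
  forall e x k, 0 < e ->
    F (x - e *: k) + e * F (x + k) <=
      (1 + e) * F x + K * (e + e `^ (1 + a)) * `|k| `^ (1 + a).

(** * Differentiability from one-sided smoothness *)

Section smooth_convex.
Variables (R : realType) (X : completeNormedModType R).
Variable dot : {dot X for idfun}.
Hypothesis dot_norm : forall x : X, dot x x = `|x| ^+ 2.
Implicit Types (x y h k : X) (a K e : R) (F : X -> R^o).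

(** Taking e = 1 bounds second differences, which gives the gradient but only the remainder constant
    2K; small e then recovers K. *)
Lemma convex_smooth_gradient a K F : 0 < a ->
  convex_function (setT : set (convex_lmodType X)) F ->
  locally_bounded_above F -> upper_smooth a K F ->
  forall x, differentiable F x /\
    forall h, F x + dot (gradient dot F x) h <= F (x + h)
      <= F x + dot (gradient dot F x) h + K * `|h| `^ (1 + a).
Proof.
move=> a0 cF Fb FK x.
have F2 h : F (x + h) + F (x - h) - 2 * F x <= 2 * K * `|h| `^ (1 + a).
  by have := FK 1 x h ltr01; rewrite scale1r powR1; lra.
have [v vP] := convex_subgradient_exists dot_norm cF Fb a0 F2.
have [dF gF] : differentiable F x /\ gradient dot F x = v.
  apply: (gradient_of_expansion dot_norm (K := 2 * K) a0) => h.
  have := vP h; have := vP (- h); have := F2 h; rewrite dotNr ler_norml.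
  by move=> *; apply/andP; split; lra.
split => // h; rewrite gF vP/=; apply/ler_addgt0Pr => e e0.
have [t t0 te] := powR_small (K * `|h| `^ (1 + a)) a0 e0.
have := FK t x h t0; have := vP (- (t *: h)); rewrite dotNr dotZr.
rewrite (powR1D (ltW t0) a0) => h1 h2.
rewrite -(ler_pM2l t0); have := ler_wpM2l (ltW t0) te; lra.
Qed.

End smooth_convex.

(** * The Whitney condition and the envelopes *)

Section whitney.
Variables (R : realType) (X : normedModType R).
Variable dot : {dot X for idfun}.
Hypothesis dot_norm : forall x : X, dot x x = `|x| ^+ 2.
Variables (a M : R).
Hypotheses (a_gt0 : 0 < a) (M_gt0 : 0 < M).
Implicit Types (xi r : R).

Let a1_gt0 : 0 < 1 + a. Proof. by rewrite addr_gt0. Qed.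

(* [(xi / M) `^ a^-1] is the point where
   [r |-> xi * r - M / (1 + a) * r `^ (1 + a)] is maximal. *)
Let conjugateE xi : 0 <= xi ->
  a / ((1 + a) * M `^ a^-1) * xi `^ (1 + a^-1) =
  a / (1 + a) * (xi * (xi / M) `^ a^-1).
Proof.
move=> xi0; rewrite powR1D ?invr_gt0// powRM ?invr_ge0 ?(ltW M_gt0)//.
rewrite powRV ?(ltW M_gt0)//; field.
by rewrite !gt_eqF ?powR_gt0.
Qed.

Let maximizerE xi : 0 <= xi ->
  M * ((xi / M) `^ a^-1) `^ (1 + a) = xi * (xi / M) `^ a^-1.
Proof.
move=> xi0; rewrite powR1D ?powR_ge0// -powRrM mulVf ?gt_eqF// powRr1.
  by field; rewrite gt_eqF.
by rewrite divr_ge0// ltW.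
Qed.

(** [powR_young] at the maximizer u = (xi/M)^(1/a): the first term on the right is the convex
    conjugate of the second. *)
Lemma powR_fenchel_young xi r : 0 <= xi -> 0 <= r ->
  xi * r <= a / ((1 + a) * M `^ a^-1) * xi `^ (1 + a^-1)
    + M / (1 + a) * r `^ (1 + a).
Proof.
move=> xi0 r0; rewrite conjugateE// -maximizerE//.
have xiM : 0 <= xi / M by rewrite divr_ge0// ltW.
have p1 : 1 <= 1 + a by rewrite lerDl ltW.
have := powR_young p1 (powR_ge0 (xi / M) a^-1) r0.
rewrite [1 + a - 1]addrAC subrr add0r -powRrM mulVf ?gt_eqF// powRr1//.
set A := _ `^ _; set B := r `^ _ => H.
have Ma0 : 0 <= M / (1 + a) by rewrite divr_ge0// ltW.
have -> : xi * r = M / (1 + a) * ((1 + a) * (xi / M) * r).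
  by field; rewrite !gt_eqF.
have -> : a / (1 + a) * (M * A) + M / (1 + a) * B = M / (1 + a) * (a * A + B).
  by field; rewrite gt_eqF.
by rewrite ler_wpM2l.
Qed.

(** Forward, Fenchel-Young with xi = |G y - G z| and r = |x - y|. Backward, x is chosen where that
    inequality is an equality. *)
Lemma whitney_convexP (E : set X) (f : X -> R) (G : X -> X) :
  whitney_convex dot a M E f G <->
  forall y z x, E y -> E z ->
    f z + dot (G z) (x - z) <=
      f y + dot (G y) (x - y) + M / (1 + a) * `|x - y| `^ (1 + a).
Proof.
have split_at y z x : dot (G z) (x - z) = dot (G z) (x - y) + dot (G z) (y - z).
  by rewrite -dotDr subrKA.
split=> [W y z x Ey Ez|H y z Ey Ez].
  have := W y z Ey Ez.
  have := powR_fenchel_young (normr_ge0 (G y - G z)) (normr_ge0 (x - y)).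
  have := dot_le dot_norm (G z - G y) (x - y).
  by rewrite distrC dotBl (split_at y z x); lra.
rewrite conjugateE//.
pose r := (`|G y - G z| / M) `^ a^-1.
(* Aligned with G z - G y and of length [r], so that Cauchy-Schwarz and Fenchel-Young are both
   sharp. If G y = G z, the quotient by zero still yields d = 0. *)
pose d : X := (r / `|G y - G z|) *: (G z - G y).
have r0 : 0 <= r by exact: powR_ge0.
have dd : dot (G z - G y) d = `|G y - G z| * r.
  rewrite /d dotZr dot_norm (distrC (G z)).
  have [->|h] := eqVneq `|G y - G z| 0.
    by rewrite invr0 mulr0 !mul0r.
  by field.
have nd : `|G y - G z| != 0 -> `|d| = r.
  move=> h; rewrite /d normrZ ger0_norm ?divr_ge0// (distrC (G z)).
  by rewrite divfK.
have nd' : `|d| `^ (1 + a) = r `^ (1 + a).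
  have [h|/nd->//] := eqVneq `|G y - G z| 0.
  rewrite /d /r h invr0 mulr0 scale0r normr0 mul0r [0 `^ a^-1]powR0//.
  by rewrite invr_eq0 gt_eqF.
have := H y z (y + d) Ey Ez.
rewrite (split_at y) (addrC y) addrK nd'.
have := maximizerE (normr_ge0 (G y - G z)); rewrite -/r => maxE.
move: dd; rewrite dotBl => dd.
have -> : M / (1 + a) * r `^ (1 + a) = (`|G y - G z| * r) / (1 + a).
  by rewrite -maxE mulrAC.
have : a / (1 + a) * (`|G y - G z| * r) + (`|G y - G z| * r) / (1 + a) =
    `|G y - G z| * r.
  by field; rewrite gt_eqF.
by lra.
Qed.

(** In the sum of the instances (y, z) and (z, y) the values of f cancel; divide by |G y - G z| and
    raise to the power a. *)
Lemma whitney_convex_hoelder (E : set X) (f : X -> R) (G : X -> X) y z :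
  whitney_convex dot a M E f G -> E y -> E z ->
  `|G y - G z| <= ((1 + a) / (2 * a)) `^ a * M * `|y - z| `^ a.
Proof.
move=> W Ey Ez; have := W y z Ey Ez; have := W z y Ez Ey.
rewrite (distrC (G z)) conjugateE//; have := normr_ge0 (G y - G z).
have := dot_le dot_norm (G y - G z) (y - z).
rewrite dotBl -[z - y]opprB dotNr.
set xi := `|G y - G z|; set r := _ `^ a^-1 => h1 xi0 h2 h3.
have [->|xiN0] := eqVneq xi 0.
  by rewrite !mulr_ge0 ?powR_ge0// ltW.
have xip : 0 < xi by rewrite lt_neqAle eq_sym xiN0.
have : 2 * (a / (1 + a)) * r <= `|y - z|.
  by rewrite -(ler_pM2l xip); lra.
have c0 : 0 <= (1 + a) / (2 * a) by rewrite divr_ge0 ?mulr_ge0 ?ltW.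
move=> /(ler_wpM2l c0).
have -> : (1 + a) / (2 * a) * (2 * (a / (1 + a)) * r) = r.
  by field; rewrite !gt_eqF.
move=> /(ler_powRl (ltW a_gt0) (powR_ge0 _ _)).
rewrite /r -powRrM mulVf ?gt_eqF// powRr1; last by rewrite divr_ge0// ltW.
by rewrite (powRM _ c0)// ler_pdivrMr// mulrAC.
Qed.

End whitney.

(** * The infimum defining g *)

Section envelope.
Variables (R : realType) (X : normedModType R).
Variable dot : {dot X for idfun}.
Hypothesis dot_norm : forall x : X, dot x x = `|x| ^+ 2.
Variables (a M : R) (E : set X) (f : X -> R) (G : X -> X).
Hypotheses (a_gt0 : 0 < a) (M_gt0 : 0 < M) (E_neq0 : E !=set0).
Hypothesis W : whitney_convex dot a M E f G.

Let g := envelope dot a M E f G.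

Let W' := (whitney_convexP dot_norm a_gt0 M_gt0 E f G).1 W.

Lemma envelope_set_has_inf x : has_inf (envelope_set dot a M E f G x).
Proof.
have [y Ey] := E_neq0; split; first by exists (f y + dot (G y) (x - y) +
  M / (1 + a) * `|x - y| `^ (1 + a)); exists y.
exists (f y + dot (G y) (x - y)) => _ [z Ez <-].
exact: W'.
Qed.

Lemma envelope_le y x : E y ->
  g x <= f y + dot (G y) (x - y) + M / (1 + a) * `|x - y| `^ (1 + a).
Proof. by move=> Ey; apply: (ge_inf (envelope_set_has_inf x).2); exists y. Qed.

Lemma envelope_ge z x : E z -> f z + dot (G z) (x - z) <= g x.
Proof.
move=> Ez; apply: lb_le_inf; first exact: (envelope_set_has_inf x).1.
move=> _ [y Ey <-]; exact: W'.
Qed.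

Lemma envelope_locally_bounded_above : locally_bounded_above (g : X -> R^o).
Proof.
move=> x; have [y Ey] := E_neq0.
exists (f y + `|G y| * (`|x - y| + 1) +
  M / (1 + a) * (`|x - y| + 1) `^ (1 + a)).
move=> h h1; apply: (le_trans (envelope_le (x + h) Ey)).
have xh : `|x + h - y| <= `|x - y| + 1.
  by rewrite addrAC (le_trans (ler_normD _ _))// lerD2l.
have a10 : 0 <= 1 + a by rewrite addr_ge0// ltW.
apply: lerD; last first.
  by apply: ler_wpM2l; [rewrite divr_ge0// ltW|exact: ler_powRl].
rewrite lerD2l; apply: (le_trans (dot_le dot_norm _ _)).
exact: ler_wpM2l.
Qed.

(** At a nearly minimizing y for x, the function indexed by y satisfies the inequality by
    [powR_norm_combination], its affine part contributing equally to both sides. *)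
Lemma envelope_upper_smooth : a <= 1 ->
  upper_smooth a (2 `^ (1 - a) * (M / (1 + a))) (g : X -> R^o).
Proof.
move=> a1 e x k e0; have a01 : 0 < a <= 1 by rewrite a_gt0.
apply/ler_addgt0Pr => d d0; have e10 : 0 < 1 + e by lra.
(* The excess of the near-minimizer gets the weight 1 + e in the final bound. *)
have d'0 : 0 < d / (1 + e) by rewrite divr_gt0.
have [_ [y Ey <-]] := inf_adherent d'0 (envelope_set_has_inf x).
rewrite -[inf _]/(g x) => yd.
have h1 := envelope_le (x - e *: k) Ey.
have h2 := ler_wpM2l (ltW e0) (envelope_le (x + k) Ey).
have M0 : 0 <= M / (1 + a) by rewrite divr_ge0 ?addr_ge0 ?ltW.
have := ler_wpM2l M0 (powR_norm_combination dot_norm (x - y) k a01 e0).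
move: h1 h2 yd; rewrite -/g.
rewrite ![_ + _ - y]addrAC !dotDr !dotNr !dotZr.
move=> h1 h2 /ltW/(ler_wpM2l (ltW e10)) h3.
have := divfK (lt0r_neq0 e10) d; move: h1 h2 h3.
move: (d / (1 + e)) (g _) (g _) (g x) (dot _ _) (dot _ _) (dot _ _) => *.
lra.
Qed.

End envelope.

(** * Suprema of convex minorants *)

Section sup_of_convex_minorants.
Variables (R : realType) (X : normedModType R).
Variables (P : (X -> R^o) -> Prop) (g : X -> R).
Implicit Types (h : X -> R^o) (x y k : X).

Let minorant h := [/\ convex_function (setT : set (convex_lmodType X)) h,
  P h & forall y, h y <= g y].

(** Common form of both envelopes: [P] is continuity for [conv_env] and the L-Lipschitz property for
    [convL_env]. *)
Definition sup_minorants x : R :=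
  sup [set r | exists h, [/\ convex_function (setT : set (convex_lmodType X)) h,
    P h, forall y, h y <= g y & r = h x]].

Hypothesis minorant_exists : exists h, minorant h.

Let has_sup_minorants x :
  has_sup [set r | exists h, [/\
    convex_function (setT : set (convex_lmodType X)) h,
    P h, forall y, h y <= g y & r = h x]].
Proof.
have [h [ch Ph hg]] := minorant_exists; split; first by exists (h x), h.
by exists (g x) => _ [h' [_ _ h'g ->]].
Qed.

Lemma sup_minorants_ge h x : minorant h -> h x <= sup_minorants x.
Proof.
by move=> [ch Ph hg]; apply: sup_upper_bound => //; exists h.
Qed.

Lemma sup_minorants_le (B : R) x :
  (forall h, minorant h -> h x <= B) -> sup_minorants x <= B.
Proof.
move=> H; apply: ge_sup; first exact: (has_sup_minorants x).1.
by move=> _ [h [ch Ph hg ->]]; exact: H.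
Qed.

Lemma sup_minorants_le_bound x : sup_minorants x <= g x.
Proof. by apply: sup_minorants_le => h []. Qed.

Lemma sup_minorants_convex :
  convex_function (setT : set (convex_lmodType X)) (sup_minorants : X -> R^o).
Proof.
apply/convex_functionP => t x y t01; have /andP[t0 t1] := t01.
apply: sup_minorants_le => h hm; have [ch _ _] := hm.
apply: (le_trans ((convex_functionP h).1 ch t x y t01)).
by rewrite lerD// ler_wpM2l ?subr_ge0// sup_minorants_ge.
Qed.

(* The weighted average of two translates of the supremum, lowered by the
   modulus of [g], is again a minorant of [g]. *)
Lemma sup_minorants_upper_smooth (a K : R) :
  (forall e k (c : R) h, 0 < e -> P h ->
    P (fun x => (1 + e)^-1 * (h (x - e *: k) + e * h (x + k)) - c)) ->
  P sup_minorants -> upper_smooth a K (g : X -> R^o) ->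
  upper_smooth a K (sup_minorants : X -> R^o).
Proof.
move=> Pavg PF gK e x k e0; have e10 : 0 < 1 + e by lra.
pose c := (1 + e)^-1 * (K * (e + e `^ (1 + a)) * `|k| `^ (1 + a)).
have := @sup_minorants_ge (fun x => (1 + e)^-1 *
  (sup_minorants (x - e *: k) + e * sup_minorants (x + k)) - c) x.
rewrite /= => H; rewrite -lerBlDr.
have : (1 + e)^-1 * (sup_minorants (x - e *: k) + e * sup_minorants (x + k)) - c
    <= sup_minorants x.
  apply: H; split; last 2 first.
  - exact: Pavg.
  - move=> y; rewrite /c -mulrBr mulrC ler_pdivrMr// lerBlDr [g y * _]mulrC.
    apply: le_trans (gK e y k e0); rewrite lerD ?sup_minorants_le_bound//.
    by rewrite ler_wpM2l ?(ltW e0)// sup_minorants_le_bound.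
  apply/convex_functionP => t y z t01.
  have shift u : t *: y + (1 - t) *: z + u = t *: (y + u) + (1 - t) *: (z + u).
    rewrite !scalerDr addrACA; congr (_ + _).
    by rewrite -scalerDl subrKC scale1r.
  have cF := (convex_functionP _).1 sup_minorants_convex t _ _ t01.
  rewrite !shift -subr_ge0.
  have := cF (y - e *: k) (z - e *: k).
  have := ler_wpM2l (ltW e0) (cF (y + k) (z + k)) => h1 h2.
  have i0 : 0 <= (1 + e)^-1 by rewrite invr_ge0 ltW.
  have := ler_wpM2l i0 (lerD h2 h1); lra.
by rewrite /c -mulrBr mulrC ler_pdivrMr//; lra.
Qed.

End sup_of_convex_minorants.

(** * Stability of the continuous and the Lipschitz minorants *)

Section minorant_classes.
Variables (R : realType) (X : normedModType R).
Implicit Types (h : X -> R^o) (x y k : X).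

Lemma continuous_avg e k (c : R) h : continuous h ->
  continuous ((fun x =>
    (1 + e)^-1 * (h (x - e *: k) + e * h (x + k)) - c) : X -> R^o).
Proof.
move=> ch x; apply: cvgB; last exact: cvg_cst.
apply: cvgM; first exact: cvg_cst.
apply: cvgD.
  apply: (@continuous_comp _ _ _ (fun x => x - e *: k) h); last exact: ch.
  by apply: cvgB; [exact: cvg_id|exact: cvg_cst].
apply: cvgM; first exact: cvg_cst.
apply: (@continuous_comp _ _ _ (fun x => x + k) h); last exact: ch.
by apply: cvgD; [exact: cvg_id|exact: cvg_cst].
Qed.

Lemma klipschitzP (L : R) h :
  L.-lipschitz h <-> forall x y, `|h x - h y| <= L * `|x - y|.
Proof. by split=> [H x y|H [x y] _]; [exact: (H (x, y))|exact: H]. Qed.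

(** The weights 1/(1+e) and e/(1+e) add up to 1, so the constant [L] is preserved. *)
Lemma klipschitz_avg (L : R) e k (c : R) h : 0 < e -> L.-lipschitz h ->
  L.-lipschitz ((fun x =>
    (1 + e)^-1 * (h (x - e *: k) + e * h (x + k)) - c) : X -> R^o).
Proof.
move=> e0 /klipschitzP Lh; apply/klipschitzP => x y.
have e10 : 0 < 1 + e by lra.
have cancel (u w : R) : u - c - (w - c) = u - w by ring.
rewrite /= cancel -mulrBr normrM gtr0_norm ?invr_gt0//.
rewrite mulrC ler_pdivrMr// opprD addrACA -mulrBr.
apply: (le_trans (ler_normD _ _)); rewrite normrM (gtr0_norm e0).
have := Lh (x - e *: k) (y - e *: k); have := Lh (x + k) (y + k).
have shift u : x + u - (y + u) = x - y by rewrite opprD addrACA subrr addr0.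
rewrite !shift.
by move=> /(ler_wpM2l (ltW e0)); lra.
Qed.

Lemma sup_minorants_lipschitz (L : R) (g : X -> R) :
  (exists h, [/\ convex_function (setT : set (convex_lmodType X)) h,
    L.-lipschitz h & forall y, h y <= g y]) ->
  L.-lipschitz (sup_minorants (fun h => L.-lipschitz h) g : X -> R^o).
Proof.
move=> hex; apply/klipschitzP.
have main x y : sup_minorants (fun h => L.-lipschitz h) g x <=
    sup_minorants (fun h => L.-lipschitz h) g y + L * `|x - y|.
  apply: sup_minorants_le => // h hm; have [_ /klipschitzP Lh _] := hm.
  have := sup_minorants_ge hex y hm.
  have := ler_norm (h x - h y); have := Lh x y; lra.
move=> x y; rewrite ler_norml; have := main x y; have := main y x.
by rewrite (distrC y) => *; apply/andP; split; lra.
Qed.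

End minorant_classes.

(** * Extension *)

Section suprema.
Variable R : realType.

Lemma esup0_le (A : set (\bar R)) (c : \bar R) :
  (0 <= c)%E -> (forall r, A r -> r <= c)%E -> (esup0 A <= c)%E.
Proof.
move=> c0 Ac; rewrite /esup0; case: ifP => // _.
exact: ge_ereal_sup.
Qed.

Lemma esup0_ge (A : set (\bar R)) r : A r -> (r <= esup0 A)%E.
Proof.
move=> Ar; rewrite /esup0; case: ifP => [/eqP A0|_].
  by move: Ar; rewrite A0.
exact: ereal_sup_ubound.
Qed.

Lemma Lip_le (X : normedModType R) (Y : normedZmodType R) (a c : R) (E : set X)
    (H : X -> Y) : 0 <= c ->
  (forall x y, E x -> E y -> `|H x - H y| <= c * `|x - y| `^ a) ->
  (Lip a E H <= c%:E)%E.
Proof.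
move=> c0 Hc; apply: esup0_le; first by rewrite lee_fin.
move=> _ [x [y [Ex Ey xy ->]]]; rewrite lee_fin.
rewrite ler_pdivrMr ?Hc// powR_gt0// normr_gt0 subr_eq0; exact/eqP.
Qed.

Lemma le_Lip (X : normedModType R) (Y : normedZmodType R) (a : R) (E : set X)
    (H : X -> Y) x y : E x -> E y -> x <> y ->
  ((`|H x - H y| / `|x - y| `^ a)%:E <= Lip a E H)%E.
Proof. by move=> Ex Ey xy; apply: esup0_ge; exists x, y. Qed.

Lemma Lip_ge0 (X : normedModType R) (Y : normedZmodType R) (a : R) (E : set X)
    (H : X -> Y) : (0 <= Lip a E H)%E.
Proof.
rewrite /Lip /esup0; case: ifPn => // /set0P[r [x [y [Ex Ey xy _]]]].
apply: (@le_trans _ _ (`|H x - H y| / `|x - y| `^ a)%:E).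
  by rewrite lee_fin divr_ge0 ?powR_ge0.
by apply: ereal_sup_ubound; exists x, y.
Qed.

Lemma Lip_hoelder (X : normedModType R) (Y : normedZmodType R) (a : R)
    (E : set X) (H : X -> Y) x y : 0 < a -> (Lip a E H < +oo)%E -> E x -> E y ->
  `|H x - H y| <= fine (Lip a E H) * `|x - y| `^ a.
Proof.
move=> a0 Lfin Ex Ey; have [->|/eqP xy] := eqVneq x y.
  by rewrite !subrr !normr0 powR0 ?gt_eqF// mulr0.
have := le_Lip a H Ex Ey xy.
rewrite -[Lip a E H]fineK ?ge0_fin_numE ?Lip_ge0// lee_fin.
rewrite ler_pdivrMr// powR_gt0// normr_gt0 subr_eq0; exact/eqP.
Qed.

(** [s] is finite, being squeezed between reals. Used for the supremum of the gradient norms and for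
    the Lipschitz constant. *)
Lemma eq_sup_EFin (T : Type) (E : set T) (N : T -> R) (s : \bar R) :
  E !=set0 -> (forall z, E z -> (N z)%:E <= s)%E ->
  (s <= (sup [set N z | z in E])%:E)%E -> s = (sup [set N z | z in E])%:E.
Proof.
move=> [z0 Ez0] lo up; apply/eqP; rewrite eq_le up /=.
have sfin : s \is a fin_num.
  by rewrite fin_numE; apply/andP; split; apply/eqP => sE;
    [have := lo _ Ez0|have := up]; rewrite sE.
rewrite -(fineK sfin) lee_fin; apply: ge_sup; first by exists (N z0), z0.
by move=> _ [z Ez <-]; rewrite -lee_fin fineK//; exact: lo.
Qed.

End suprema.

(** * Necessity of the Whitney condition *)

Section convex_C1.
Variables (R : realType) (X : completeNormedModType R).
Variable dot : {dot X for idfun}.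
Hypothesis dot_norm : forall x : X, dot x x = `|x| ^+ 2.
Variables (F : X -> R^o).
Hypothesis cF : convex_function (setT : set (convex_lmodType X)) F.

(** For small t the increment F(x + t h) - F x is at least t times the derivative minus e t |h|, and
    by convexity at most t (F(x + h) - F x); divide by t and let e -> 0. *)
Lemma convex_gradient_le x h : differentiable F x ->
  F x + dot (gradient dot F x) h <= F (x + h).
Proof.
move=> dF; rewrite -(diff_gradient dot_norm h dF).
apply: (@ler_add_divn _ _ _ `|h|) => n.
set e : R := n.+1%:R^-1; have e0 : 0 < e by rewrite invr_gt0.
have [_ /eqaddoP/(_ _ e0)/nbhs_norm0P[/= d d0 near0]] :=
  (diff_locallyP _ _).1 dF.
have C0 : 0 < `|h| + 1 by rewrite ltr_wpDl.
(* Capped at 1 to stay on the segment; the other bound gives |t h| < d, its [+ 1] covering h = 0. *)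
pose t := Num.min 1 (d / (2 * (`|h| + 1))).
have t0 : 0 < t by rewrite lt_min ltr01 divr_gt0// mulr_gt0.
have t1 : t <= 1 by rewrite ge_min lexx.
have td : `|t *: h| < d.
  rewrite normrZ gtr0_norm//.
  apply: (@le_lt_trans _ _ (d / (2 * (`|h| + 1)) * (`|h| + 1))).
    by apply: ler_pM => //; [exact: ltW|rewrite ge_min lexx orbT|rewrite lerDl].
  by rewrite invfM mulrA divfK ?gt_eqF// ltr_pdivrMr//; lra.
have := near0 (t *: h) td.
have -> : (F \o +%R^~ x - (cst (F x) + ('d F x : X -> R^o))) (t *: h) =
    F (x + t *: h) - F x - t * 'd F x h.
  have <- : 'd F x (t *: h) = t * 'd F x h by rewrite linearZ.
  by rewrite [in RHS](addrC x) -addrA -opprD.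
rewrite normrZ gtr0_norm// ler_norml => /andP[lo _].
have t01 : 0 <= t <= 1 by rewrite t1 ltW.
have := convex_segment cF x h t01 => up.
by rewrite -(ler_pM2l t0) [`|h| / _]mulrC -/e; lra.
Qed.

(** The tangent at z lies below F x; the tangent at x, evaluated at y, and the Hoelder bound give F
    x <= F y + <grad F(y), x - y> + C |x - y|^(1+a). Using C + 1 keeps M positive. *)
Lemma convex_C1_whitney a : 0 < a -> C1 dot a F ->
  exists M, 0 < M /\ whitney_convex dot a M setT F (gradient dot F).
Proof.
move=> a0 [dF _ LipF]; set H := gradient dot F.
pose C := fine (Lip a setT H).
have C0 : 0 <= C by rewrite fine_ge0// Lip_ge0.
have a10 : 0 < 1 + a by lra.
have M0 : 0 < (1 + a) * (C + 1) by rewrite mulr_gt0//; lra.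
exists ((1 + a) * (C + 1)); split => //.
apply/(whitney_convexP dot_norm a0 M0) => y z x _ _.
have := convex_gradient_le (x - z) (dF z); rewrite subrKC => /le_trans; apply.
have h1 : F x - dot (H x) (x - y) <= F y.
  by have := convex_gradient_le (- (x - y)) (dF x); rewrite dotNr opprB subrKC.
have h2 : dot (H x) (x - y) - dot (H y) (x - y) <= C * `|x - y| `^ (1 + a).
  rewrite -dotBl; apply: le_trans (dot_le dot_norm _ _) _.
  rewrite powR1D// [leRHS]mulrCA [leLHS]mulrC ler_wpM2l//.
  exact: Lip_hoelder.
have -> : (1 + a) * (C + 1) / (1 + a) = C + 1 by field; rewrite gt_eqF.
have := powR_ge0 `|x - y| (1 + a); move: h1 h2.
by move: (C) (F x) (F y) (dot _ _) (dot _ _) (_ `^ _) => *; lra.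
Qed.

End convex_C1.

(** * Smooth convex functions between the tangents and g *)

Section extension.
Variables (R : realType) (X : completeNormedModType R).
Variable dot : {dot X for idfun}.
Hypothesis dot_norm : forall x : X, dot x x = `|x| ^+ 2.
Variables (a M : R) (E : set X) (f : X -> R) (G : X -> X).
Hypotheses (a_gt0 : 0 < a) (M_gt0 : 0 < M) (E_neq0 : E !=set0).
Hypothesis W : whitney_convex dot a M E f G.

Let g := envelope dot a M E f G.
Let K := 2 `^ (1 - a) * (M / (1 + a)).

Lemma smooth_extension (F : X -> R^o) :
  convex_function (setT : set (convex_lmodType X)) F ->
  (forall z x, E z -> f z + dot (G z) (x - z) <= F x) ->
  (forall x, F x <= g x) ->
  upper_smooth a K F ->
  [/\ extends_jet dot a E f G F,
      (Aco dot a setT F (gradient dot F) <= (2 `^ (1 - a) * M)%:E)%E &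
      (Lip a setT (gradient dot F) <=
        (2 `^ (1 - a) * ((1 + a) / (2 * a)) `^ a * M)%:E)%E].
Proof.
move=> cF lo up FK; have a10 : 0 < 1 + a by rewrite addr_gt0.
have Fb : locally_bounded_above F.
  move=> x; have [B gB] :=
    envelope_locally_bounded_above dot_norm a_gt0 M_gt0 E_neq0 W x.
  by exists B => h /gB; apply: le_trans.
have grad := convex_smooth_gradient dot_norm a_gt0 cF Fb FK.
have gle := envelope_le dot_norm a_gt0 M_gt0 E_neq0 W.
have jet y : E y -> F y = f y /\ gradient dot F y = G y.
  move=> Ey; have Fy : F y = f y.
    apply/eqP; rewrite eq_le; apply/andP; split.
      apply: (le_trans (up y)); apply: (le_trans (gle y y Ey)).
      by rewrite subrr dot0r normr0 powR0 ?gt_eqF// mulr0 !addr0.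
    by have := lo y y Ey; rewrite subrr dot0r addr0.
  split=> //.
  (* Near y, F lies between the affine function at y and the function indexed by y in the infimum;
     these differ by M/(1+a) |h|^(1+a). *)
  apply: (gradient_of_expansion dot_norm (K := M / (1 + a)) a_gt0 _).2 => h.
  have := lo y (y + h) Ey; have := gle y (y + h) Ey.
  have := up (y + h); rewrite -/g [y + h - y]addrAC subrr add0r Fy ler_norml.
  have : 0 <= M / (1 + a) * `|h| `^ (1 + a).
    by rewrite mulr_ge0 ?powR_ge0// divr_ge0 ?ltW.
  by move=> *; apply/andP; split; lra.
pose M' := 2 `^ (1 - a) * M.
have M'0 : 0 < M' by rewrite mulr_gt0 ?powR_gt0.
have KE : K = M' / (1 + a) by rewrite /K /M' mulrA.
(* The tangent at z bounds F x from below, the smoothness estimate at y from above. This is both the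
   [Aco] bound and the Whitney condition with constant M'. *)
have two_sided y z x : F z + dot (gradient dot F z) (x - z) <=
    F y + dot (gradient dot F y) (x - y) + M' / (1 + a) * `|x - y| `^ (1 + a).
  have [_ /(_ (x - z))] := grad z; have [_ /(_ (x - y))] := grad y.
  by rewrite !subrKC -KE => /andP[_ h1] /andP[h2 _]; exact: le_trans h1.
have WF : whitney_convex dot a M' setT F (gradient dot F).
  by apply/(whitney_convexP dot_norm a_gt0 M'0) => y z x _ _; exact: two_sided.
pose c := 2 `^ (1 - a) * ((1 + a) / (2 * a)) `^ a * M.
have c0 : 0 <= c by rewrite !mulr_ge0 ?powR_ge0// ltW.
have hold y z : `|gradient dot F y - gradient dot F z| <= c * `|y - z| `^ a.
  have := whitney_convex_hoelder dot_norm a_gt0 M'0 WF (y := y) (z := z) I I.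
  by rewrite /M' /c mulrCA !mulrA.
have LipF : (Lip a setT (gradient dot F) <= c%:E)%E.
  by apply: Lip_le => // x y _ _; exact: hold.
split=> //; first split=> //.
  split; first by move=> x; have [] := grad x.
    move=> x; apply/cvgrPdist_le => /= e e0.
    have [t t0 te] := powR_small c a_gt0 e0.
    apply/nbhs_normP; exists t => //= y /= xy.
    apply: (le_trans (hold x y)); apply: le_trans te.
    by rewrite ler_wpM2l// ler_powRl// ltW.
  by apply: le_lt_trans LipF _; rewrite ltry.
apply: esup0_le; first by rewrite lee_fin ltW.
move=> _ [y [z [x [_ _ xy ->]]]]; rewrite lee_fin.
have xy0 : 0 < `|x - y| by rewrite normr_gt0 subr_eq0; exact/eqP.
rewrite ler_pdivrMr ?mulr_gt0 ?invr_gt0 ?powR_gt0//.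
have := two_sided y z x; rewrite -[2 `^ (1 - a) * M]/M'.
by move: (M') (F y) (F z) (dot _ _) (dot _ _) (_ `^ _) => *; lra.
Qed.

End extension.

(** * Affine functions as minorants *)

Section affine_minorants.
Variables (R : realType) (X : completeNormedModType R).
Variable dot : {dot X for idfun}.
Hypothesis dot_norm : forall x : X, dot x x = `|x| ^+ 2.
Implicit Types (c : R) (v z : X).

Lemma affine_convex c v z : convex_function (setT : set (convex_lmodType X))
  ((fun x => c + dot v (x - z)) : X -> R^o).
Proof.
by apply/convex_functionP => t x y _; rewrite !dotBr dotDr !dotZr; lra.
Qed.

Lemma affine_continuous c v z :
  continuous ((fun x => c + dot v (x - z)) : X -> R^o).
Proof.
move=> x; apply: cvgD; first exact: cvg_cst.
apply: (@continuous_comp _ _ _ (fun x => x - z) (dot v : X -> R^o)).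
  by apply: cvgB; [exact: cvg_id|exact: cvg_cst].
exact: dot_continuous.
Qed.

Lemma affine_lipschitz (L : R) c v z : `|v| <= L ->
  L.-lipschitz ((fun x => c + dot v (x - z)) : X -> R^o).
Proof.
move=> vL; apply/klipschitzP => x y.
have -> : c + dot v (x - z) - (c + dot v (y - z)) = dot v (x - y).
  by rewrite !dotBr; ring.
apply: (@le_trans _ _ (`|v| * `|x - y|)); last exact: ler_wpM2r.
by rewrite ler_norml (dot_ge dot_norm) (dot_le dot_norm).
Qed.

Lemma affine_functionE c v z :
  affine_function ((fun x => c + dot v (x - z)) : X -> R^o).
Proof.
by exists (dot v : {linear X -> R^o}), (c - dot v z) => x; rewrite dotBr; ring.
Qed.

End affine_minorants.

(** * The two convex envelopes as extensions *)

Section envelopes_extend.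
Variables (R : realType) (X : completeNormedModType R).
Variable dot : {dot X for idfun}.
Hypothesis dot_norm : forall x : X, dot x x = `|x| ^+ 2.
Variables (a M : R) (E : set X) (f : X -> R) (G : X -> X).
Hypotheses (a_gt0 : 0 < a) (a_le1 : a <= 1) (M_gt0 : 0 < M) (E_neq0 : E !=set0).
Hypothesis W : whitney_convex dot a M E f G.

Let g := envelope dot a M E f G.

Let affine z : X -> R^o := fun x => f z + dot (G z) (x - z).

Let affine_le z x : E z -> affine z x <= g x.
Proof. exact: (envelope_ge dot_norm a_gt0 M_gt0 E_neq0 W). Qed.

(** Reduces each envelope to three properties of the class [P]: it contains the tangents, is stable
    under the weighted averages, and contains its own supremum. *)
Lemma sup_minorants_extension (P : (X -> R^o) -> Prop) :
  (forall z, E z -> P (affine z)) ->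
  (forall e k (c : R) (h : X -> R^o), 0 < e -> P h ->
    P (fun x => (1 + e)^-1 * (h (x - e *: k) + e * h (x + k)) - c)) ->
  P (sup_minorants P g) ->
  let F := sup_minorants P g in
  [/\ extends_jet dot a E f G F,
      (Aco dot a setT F (gradient dot F) <= (2 `^ (1 - a) * M)%:E)%E &
      (Lip a setT (gradient dot F) <=
        (2 `^ (1 - a) * ((1 + a) / (2 * a)) `^ a * M)%:E)%E].
Proof.
move=> Paff Pavg PF F; have [z0 Ez0] := E_neq0.
have minorant z : E z ->
    [/\ convex_function (setT : set (convex_lmodType X)) (affine z),
    P (affine z) & forall x, affine z x <= g x].
  move=> Ez; split; [exact: affine_convex|exact: Paff|].
  by move=> x; exact: affine_le.
have hex : exists h, [/\ convex_function (setT : set (convex_lmodType X)) h,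
    P h & forall y, h y <= g y] by exists (affine z0); exact: minorant.
apply: (smooth_extension dot_norm a_gt0 M_gt0 E_neq0 W).
- exact: sup_minorants_convex.
- by move=> z x Ez; apply: (sup_minorants_ge hex x (minorant z Ez)).
- by move=> x; exact: sup_minorants_le_bound.
- apply: sup_minorants_upper_smooth => //.
  exact: envelope_upper_smooth.
Qed.

Lemma conv_env_extension :
  let F := conv_env g in
  [/\ extends_jet dot a E f G F,
      (Aco dot a setT F (gradient dot F) <= (2 `^ (1 - a) * M)%:E)%E &
      (Lip a setT (gradient dot F) <=
        (2 `^ (1 - a) * ((1 + a) / (2 * a)) `^ a * M)%:E)%E].
Proof.
have [z0 Ez0] := E_neq0.
have hex : exists h : X -> R^o,
    [/\ convex_function (setT : set (convex_lmodType X)) h,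
    continuous h & forall y, h y <= g y].
  exists (affine z0); split; [exact: affine_convex|exact: affine_continuous|].
  by move=> x; exact: affine_le.
apply: (@sup_minorants_extension (fun h => continuous h)).
- by move=> z _; exact: affine_continuous.
- by move=> e k c h _; exact: continuous_avg.
(* A supremum of continuous functions need not be continuous; here convexity and the local upper
   bound of g give continuity. *)
- apply: convex_bounded_continuous; first exact: sup_minorants_convex hex.
  move=> x; have [B gB] :=
    envelope_locally_bounded_above dot_norm a_gt0 M_gt0 E_neq0 W x.
  by exists B => h /gB; apply: le_trans; exact: (sup_minorants_le_bound hex).
Qed.

Hypothesis G_bounded : [bounded G z | z in E].

Let L := sup [set `|G z| | z in E].

Lemma norm_le_sup_bounded z : E z -> `|G z| <= L.
Proof.
move=> Ez; apply: ub_le_sup; last by exists z.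
have [B B0 GB] := pinfty_ex_gt0 G_bounded.
by exists B => _ [y Ey <-]; exact: GB.
Qed.

Let L_ge0 : 0 <= L.
Proof. by have [z /norm_le_sup_bounded] := E_neq0; exact: le_trans. Qed.

Let lipschitz_minorant_exists : exists h : X -> R^o,
    [/\ convex_function (setT : set (convex_lmodType X)) h,
    L.-lipschitz h & forall y, h y <= g y].
Proof.
have [z Ez] := E_neq0; exists (affine z).
split; [exact: affine_convex| |by move=> x; exact: affine_le].
by apply: affine_lipschitz => //; exact: norm_le_sup_bounded.
Qed.

Let F := convL_env L g.

Lemma convL_env_lipschitz : L.-lipschitz (F : X -> R^o).
Proof. exact: (sup_minorants_lipschitz lipschitz_minorant_exists). Qed.

Lemma convL_env_extension :
  [/\ extends_jet dot a E f G F,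
      (Aco dot a setT F (gradient dot F) <= (2 `^ (1 - a) * M)%:E)%E &
      (Lip a setT (gradient dot F) <=
        (2 `^ (1 - a) * ((1 + a) / (2 * a)) `^ a * M)%:E)%E].
Proof.
apply: (@sup_minorants_extension (fun h => L.-lipschitz h)).
- by move=> z Ez; apply: affine_lipschitz => //; exact: norm_le_sup_bounded.
- by move=> e k c h e0; exact: klipschitz_avg.
- exact: convL_env_lipschitz.
Qed.

(** Moving from x by grad F(x) raises F by at least |grad F(x)|^2. Against the L-Lipschitz bound
    this gives |grad F(x)| <= L; at z in E it exhibits a difference quotient of at least |G z|. *)
Lemma convL_env_sharp_lipschitz :
  ereal_sup [set `|gradient dot F x|%:E | x in setT] = L%:E /\
  Lip 1 setT (F : X -> R^o) = L%:E.
Proof.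
have [[cF [dF _ _] jet] _ _] := convL_env_extension.
have /klipschitzP lipF := convL_env_lipschitz.
have steep x : `|gradient dot F x| ^+ 2 <= F (x + gradient dot F x) - F x.
  by rewrite -dot_norm lerBrDl; exact: convex_gradient_le.
split; apply: (eq_sup_EFin E_neq0).
- move=> z Ez; apply: ereal_sup_ubound; exists z => //.
  by rewrite (jet z Ez).2.
- apply: ge_ereal_sup => _ [x _ <-]; rewrite lee_fin.
  have [->|v0] := eqVneq (`|gradient dot F x|) 0; first exact: L_ge0.
  have vp : 0 < `|gradient dot F x| by rewrite lt_neqAle eq_sym v0/=.
  rewrite -(ler_pM2r vp) -expr2; apply: (le_trans (steep x)).
  apply: (le_trans (ler_norm _)); apply: (le_trans (lipF _ _)).
  by rewrite addrC addrA addNr add0r.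
- move=> z Ez; have [->|v0] := eqVneq (G z) 0; first by rewrite normr0 Lip_ge0.
  have vp : 0 < `|G z| by rewrite normr_gt0.
  have zGz : z + G z <> z.
    by move/eqP; rewrite -subr_eq0 addrAC subrr add0r (negPf v0).
  apply: (le_trans _ (@le_Lip _ _ _ 1 setT (F : X -> R^o) _ _ I I zGz)).
  rewrite lee_fin addrAC subrr add0r powRr1// ler_pdivlMr// -expr2.
  have := steep z; rewrite (jet z Ez).2 => /le_trans; apply; exact: ler_norm.
- apply: Lip_le => // x y _ _; rewrite powRr1//; exact: lipF.
Qed.

End envelopes_extend.

Theorem theorem1p4 (R : realType) (X : completeNormedModType R)
    (dot : {dot X for idfun}) (dot_norm : forall x : X, dot x x = `|x| ^+ 2)
    (a : R) (a_gt0 : 0 < a) (a_le1 : a <= 1)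
    (E : set X) (E_neq0 : E !=set0) (f : X -> R) (G : X -> X) :
  [/\
    (* (i) *)
    (exists F : X -> R^o, extends_jet dot a E f G F) <->
    (exists M : R, 0 < M /\ whitney_convex dot a M E f G),
    (* (ii) *)
    forall M : R, 0 < M -> whitney_convex dot a M E f G ->
      let g := envelope dot a M E f G in
      let F := conv_env g in
      [/\ forall x, has_inf (envelope_set dot a M E f G x),
          exists h : X -> R^o,
            [/\ affine_function h, continuous h & forall x, h x <= g x],
          extends_jet dot a E f G F,
          (Aco dot a setT F (gradient dot F) <= (2 `^ (1 - a) * M)%:E)%E &
          (Lip a setT (gradient dot F) <=
            (2 `^ (1 - a) * ((1 + a) / (2 * a)) `^ a * M)%:E)%E] &
    (* (iii) *)
    forall M : R, 0 < M -> whitney_convex dot a M E f G ->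
      [bounded G z | z in E] ->
      let g := envelope dot a M E f G in
      let L := sup [set `|G z| | z in E] in
      let F := convL_env L g in
      [/\ exists h : X -> R^o,
            [/\ affine_function h, L.-lipschitz h & forall x, h x <= g x],
          extends_jet dot a E f G F,
          (Aco dot a setT F (gradient dot F) <= (2 `^ (1 - a) * M)%:E)%E,
          (Lip a setT (gradient dot F) <=
            (2 `^ (1 - a) * ((1 + a) / (2 * a)) `^ a * M)%:E)%E &
          ereal_sup [set `|gradient dot F x|%:E | x in setT] = L%:E /\
          Lip 1 setT F = L%:E]].
Proof.
have [z0 Ez0] := E_neq0.
(* The tangent at one point of E serves as the affine minorant in both (ii) and (iii). *)
pose h0 : X -> R^o := fun x => f z0 + dot (G z0) (x - z0).
have h0_affine : affine_function h0 by exact: affine_functionE.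
split.
- split=> [[F [cF C1F jet]]|[M [M0 W]]].
    (* Necessity: the condition holds for F on all of X and is restricted to E. *)
    have [M [M0 WF]] := convex_C1_whitney dot_norm cF a_gt0 C1F.
    exists M; split=> // y z Ey Ez.
    have [Fy Gy] := jet y Ey; have [Fz Gz] := jet z Ez.
    by have := WF y z I I; rewrite Fy Gy Fz Gz.
  exists (conv_env (envelope dot a M E f G)).
  by have [] := conv_env_extension dot_norm a_gt0 a_le1 M0 E_neq0 W.
- move=> M M0 W g F.
  have [jet acoF lipF] := conv_env_extension dot_norm a_gt0 a_le1 M0 E_neq0 W.
  split=> //; first exact: (envelope_set_has_inf dot_norm a_gt0 M0 E_neq0 W).
  exists h0; split=> //; first exact: affine_continuous.
  by move=> x; exact: (envelope_ge dot_norm a_gt0 M0 E_neq0 W).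
- move=> M M0 W Gb g L F.
  have [jet acoF lipF] :=
    convL_env_extension dot_norm a_gt0 a_le1 M0 E_neq0 W Gb.
  split=> //.
    exists h0; split=> //.
      by apply: affine_lipschitz => //; exact: norm_le_sup_bounded.
    by move=> x; exact: (envelope_ge dot_norm a_gt0 M0 E_neq0 W).
  exact: (convL_env_sharp_lipschitz dot_norm a_gt0 a_le1 M0 E_neq0 W Gb).
Qed.
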